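(* Let $M=D^2\times S^1$ be the solid flat torus and let $X=u(r)\,\partial_\theta$, not identically zero. If $\frac{d}{dr}\big(ru(r)^2\big)\ge0$ for all $0<r<1$, then the sectional curvature of $\mathcal{D}_{\mu,E}(M)$ satisfies $K(X,Y)\ge0$ for every $Y\in T_{\mathrm{id}}\mathcal{D}_{\mu,E}(M)$ that is linearly independent of $X$.
   Context: $M=D^2\times S^1$, where $D^2\subset\mathbb{R}^2$ is the closed unit disk and $S^1=\mathbb{R}/2\pi\mathbb{Z}$, has the flat metric $dr^2+r^2d\theta^2+dz^2$ in cylindrical coordinates ($0\le r\le 1$, $\theta$ and $z$ being $2\pi$-periodic), with volume form $\mu=r\,dr\,d\theta\,dz$. All vector fields are smooth; in particular $u$ is a real function such that $X=u(r)\partial_\theta$ is smooth on $M$. $\mathcal{D}_\mu(M)$ is the group of volume-preserving diffeomorphisms of $M$ with the weak $L^2$ Riemannian metric, whose tangent space at the identity consists of divergence-free fields tangent to $\partial M$, with inner product $\langle\!\langle V,W\rangle\!\rangle=\int_M\langle V,W\rangle\,\mu$. $\mathcal{D}_{\mu,E}(M)$ is the totally geodesic submanifold of those volume-preserving diffeomorphisms commuting with the flow of $E=\partial_\theta$; its tangent space $T_{\mathrm{id}}\mathcal{D}_{\mu,E}(M)$ at the identity consists of (real) divergence-free fields $Y$ tangent to $\partial M$ with $[E,Y]=0$. For a vector field $V$, $P(V)=V-\nabla q$ is the projection onto the divergence-free part, where $q$ solves $\Delta q=\operatorname{div}V$ in $M$, $\langle\nabla q,\vec n\rangle=\langle V,\vec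 n\rangle$ on $\partial M$, with $\vec n$ the unit normal. With $\nabla$ the Levi-Civita connection of $M$, the curvature tensor is $$R(Y,X)X=P\big(\nabla_YP(\nabla_XX)-\nabla_XP(\nabla_YX)+\nabla_{[X,Y]}X\big),$$ and the sectional curvature is $$K(X,Y)=\frac{\langle\!\langle R(Y,X)X,Y\rangle\!\rangle}{\langle\!\langle X,X\rangle\!\rangle\langle\!\langle Y,Y\rangle\!\rangle-\langle\!\langle X,Y\rangle\!\rangle^2}.$$ *)

(* Defs.v *)
(* MathComp-Analysis, over an arbitrary R : realType.

   The solid torus D^2 x S^1, with S^1 = R / 2 pi Z, is handled through its
   universal cover D^2 x R, a closed subset of R^3 with Cartesian coordinates
   (x, y, z) = (r cos theta, r sin theta, z).  A smooth function or vector field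
   on the torus is represented by a smooth map on R^3 which is 2 pi-periodic
   in z; every smooth object on the manifold with boundary D^2 x S^1 has such an
   extension.  Conditions are only imposed, and integrals only taken, over
   D^2 x R.  Its interior is dense in it, so the derivatives of a representative
   at points of D^2 x R, boundary included, do not depend on the extension. *)
From HB Require Import structures.
From mathcomp Require Import all_boot all_order all_algebra.
From mathcomp Require Import all_classical all_reals all_analysis.

Set Implicit Arguments.
Unset Strict Implicit.
Unset Printing Implicit Defensive.

Import Order.TTheory GRing.Theory Num.Theory.
Import numFieldNormedType.Exports.

Local Open Scope classical_set_scope.
Local Open Scope ring_scope.

Section SolidTorus.
Context {R : realType}.

Notation point := 'rV[R]_3.
Notation vfield := ('rV[R]_3 -> 'rV[R]_3).

Definition ix : 'I_3 := @Ordinal 3 0 isT.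
Definition iy : 'I_3 := @Ordinal 3 1 isT.

Definition vec3 (x y z : R) : point := \row_(i < 3) [:: x; y; z]`_i.

Definition cyl_radius (p : point) : R := Num.sqrt (p 0 ix ^+ 2 + p 0 iy ^+ 2).

Definition solid_torus : set point := [set p | cyl_radius p <= 1].
Definition torus_boundary : set point := [set p | cyl_radius p = 1].

Definition dot (v w : point) : R := \sum_(i < 3) v 0 i * w 0 i.

Definition partial (W : normedModType R) (i : 'I_3) (f : point -> W) :
  point -> W := fun p => 'D_(delta_mx 0 i) f p.

Fixpoint Ck (W : normedModType R) (k : nat) (f : point -> W) : Prop :=
  match k with
  | 0 => continuous f
  | k'.+1 => (forall p, differentiable f p) /\ forall i, Ck k' (partial i f)
  end.

Definition smooth (W : normedModType R) (f : point -> W) : Prop :=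
  forall k, Ck k f.

Definition z_periodic (T : Type) (f : point -> T) : Prop :=
  forall p, f (p + vec3 0 0 (2 * pi)) = f p.

Definition smooth_on_torus (W : normedModType R) (f : point -> W) : Prop :=
  smooth f /\ z_periodic f.

(* The rotation field d/dtheta. *)
Definition rotE : vfield := fun p => vec3 (- p 0 iy) (p 0 ix) 0.

(* Equals the outward unit normal at points of the boundary. *)
Definition outward_normal : vfield := fun p => vec3 (p 0 ix) (p 0 iy) 0.

Definition grad (q : point -> R) : vfield :=
  fun p => \row_(i < 3) partial i q p.

Definition divergence (V : vfield) (p : point) : R :=
  \sum_(i < 3) (partial i V p) 0 i.

Definition laplacian (q : point -> R) (p : point) : R :=
  \sum_(i < 3) partial i (partial i q) p.

(* The Levi-Civita derivative nabla_V W: the metric being flat, it is the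
   directional derivative of the Cartesian components of W. *)
Definition nabla (V W : vfield) : vfield := fun p => 'D_(V p) W p.

Definition lie_bracket (V W : vfield) : vfield := nabla V W \- nabla W V.

(* Integration against mu = r dr dtheta dz. *)
Definition torus_integral (f : point -> R) : R :=
  (\int[lebesgue_measure]_(z in `[0%R, (2 * pi)%R])
    \int[lebesgue_measure]_(t in `[0%R, (2 * pi)%R])
     \int[lebesgue_measure]_(r in `[0%R, 1%R])
       (f (vec3 (r * cos t) (r * sin t) z) * r))%R.

Definition L2inner (V W : vfield) : R :=
  torus_integral (fun p => dot (V p) (W p)).

Definition neumann_solution (V : vfield) (q : point -> R) : Prop :=
  [/\ smooth_on_torus q,
      forall p, solid_torus p -> laplacian q p = divergence V p &
      forall p, torus_boundary p ->
        dot (grad q p) (outward_normal p) = dot (V p) (outward_normal p)].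

(* P(V) = V - grad q.  The Neumann problem has a solution for every smooth V,
   and grad q is then unique on the torus; the default value 0 only
   makes the operator total, and the choice of q is immaterial. *)
Definition div_free_proj (V : vfield) : vfield :=
  V \- grad (xget (fun=> 0) (neumann_solution V)).

(* R(Y, X)X *)
Definition curvature (Y X : vfield) : vfield :=
  div_free_proj
    ((nabla Y (div_free_proj (nabla X X)) \- nabla X (div_free_proj (nabla Y X)))
       \+ nabla (lie_bracket X Y) X).

Definition sectional_curvature (X Y : vfield) : R :=
  L2inner (curvature Y X) Y /
    (L2inner X X * L2inner Y Y - L2inner X Y ^+ 2).

(* The tangent space at the identity of D_{mu,E}(M). *)
Definition tangent_DmuE (Y : vfield) : Prop :=
  [/\ smooth_on_torus Y,
      forall p, solid_torus p -> divergence Y p = 0,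
      forall p, torus_boundary p -> dot (Y p) (outward_normal p) = 0 &
      forall p, solid_torus p -> lie_bracket rotE Y p = 0].

Definition lin_indep_on_torus (X Y : vfield) : Prop :=
  forall a b : R,
    (forall p, solid_torus p -> a *: X p + b *: Y p = 0) -> a = 0 /\ b = 0.

End SolidTorus.

(* Main.v *)
(* Write w(r) = r u(r) and g for the pressure gradient of nabla_Y X.  On the torus
   nabla_X X = - u^2 (x, y, 0) is a gradient, so its projection vanishes in L^2 and the first
   term of the curvature integrates to zero against Y.  Integrating the second term by parts
   along X gives
     << R(Y, X)X, Y >> = << nabla_Y X - g, nabla_X Y >> + << nabla_[X, Y] X, Y >>.
   In the frame (e_r, e_theta, e_z), with Y = (a, b, c) independent of theta, one has
   nabla_Y X = (- u b, w' a, 0) and nabla_X Y = (- u b, u a, 0).  Two vanishing integrals are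
   added: << g, g - nabla_Y X >>, since g is orthogonal to the projection of nabla_Y X, and that
   of (u + w') a g_theta, since r g_theta is a theta-derivative.  The integrand becomes
     (r u^2)' a^2 + (u b + g_r)^2 + g_theta^2 + g_z^2. *)

(* The definition of [div_free_proj] comes with no solution of the Neumann problem. The outer
   projection in [curvature] and that of nabla_Y X enter only through orthogonality relations, valid
   for a solution and for the default value alike. The projection of nabla_X X has to vanish, so
   there a smooth potential is built explicitly, by averaging along rays from the axis. The pressure
   gradient g has no closed form. Only its being a gradient is used, and the mixed terms must
   therefore be absorbed: 2 u b g_r completes a square, while the remaining one, - (u + w') a
   g_theta, is removed by an integral over circles. This works because [E, Y] = 0 makes the radial
   component a independent of theta; the same condition turns nabla_X Y into an algebraic expression
   in Y. The formulas for X hold only on the closed solid torus, and regularity is given for X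
   rather than for [u]. Derivatives are thus taken of [speed], read off from X. Computations in the
   frame are done for 0 < r < 1, which is enough for the sign of an integral; the pointwise
   identities required on the whole torus reach the axis and the boundary by continuity. *)
Require Import Defs.
From HB Require Import structures.
From mathcomp Require Import all_boot all_order all_algebra ring lra.
From mathcomp Require Import all_classical all_reals all_analysis.
Set Implicit Arguments.
Unset Strict Implicit.
Unset Printing Implicit Defensive.
Import Order.TTheory GRing.Theory Num.Theory.
Import numFieldNormedType.Exports.
Local Open Scope classical_set_scope.
Local Open Scope ring_scope.

(** * Integrals over segments *)

Section Continuity.
Context {S T U : topologicalType}.

Lemma continuous_fcomp (f : S -> T) (g : T -> U) :
  continuous f -> continuous g -> continuous (fun x => g (f x)).
Proof. by move=> cf cg x; apply: continuous_comp; [exact: cf|exact: cg]. Qed.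

Lemma continuous_pairf (f : S -> T) (g : S -> U) :
  continuous f -> continuous g -> continuous (fun x => (f x, g x)).
Proof. by move=> cf cg x; apply: cvg_pair; [exact: cf|exact: cg]. Qed.

Lemma continuous_idf : continuous (fun x : S => x).
Proof. by move=> x; exact: cvg_id. Qed.

Lemma continuous_cstf (c : T) : continuous (fun _ : S => c).
Proof. exact: cst_continuous. Qed.

Lemma continuous_fstf : continuous (fun x : S * T => x.1).
Proof. by move=> x; exact: cvg_fst. Qed.

Lemma continuous_sndf : continuous (fun x : S * T => x.2).
Proof. by move=> x; exact: cvg_snd. Qed.

End Continuity.

Section SegmentIntegral.
Context {R : realType}.
Notation mu := (@lebesgue_measure R).
Implicit Types (f g : R -> R) (a b : R).

Definition segint a b f : R := \int[mu]_(x in `[a, b]) f x.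

Lemma continuous_segment_integrable f a b :
  continuous f -> mu.-integrable `[a, b] (EFin \o f).
Proof.
move=> cf; apply: continuous_compact_integrable; first exact: segment_compact.
exact: continuous_subspaceT.
Qed.

Lemma segintD f g a b : continuous f -> continuous g ->
  segint a b (fun x => f x + g x) = segint a b f + segint a b g.
Proof. by move=> cf cg; apply: RintegralD => //; exact: continuous_segment_integrable. Qed.

Lemma segintB f g a b : continuous f -> continuous g ->
  segint a b (fun x => f x - g x) = segint a b f - segint a b g.
Proof. by move=> cf cg; apply: RintegralB => //; exact: continuous_segment_integrable. Qed.

Lemma segintZ k f a b : continuous f ->
  segint a b (fun x => k * f x) = k * segint a b f.
Proof. by move=> cf; apply: RintegralZl => //; exact: continuous_segment_integrable. Qed.

Lemma eq_segint f g a b : (forall x, a <= x <= b -> f x = g x) ->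
  segint a b f = segint a b g.
Proof. by move=> fg; apply: eq_Rintegral => x /[!inE]/= /[!in_itv]/= /fg. Qed.

Lemma segint0 a b : segint a b (fun=> 0) = 0.
Proof. by rewrite /segint Rintegral_cst// mul0r. Qed.

Lemma segint_cst k a b : a <= b -> segint a b (fun=> k) = k * (b - a).
Proof.
move=> ab; rewrite /segint Rintegral_cst//= lebesgue_measure_itv/= lte_fin.
case: ltP => //= ba.
have -> : a = b by apply/eqP; rewrite eq_le ab.
by rewrite subrr.
Qed.

(** The endpoints form a null set. Strict inequalities matter later: the condition on [u] is given
    for [0 < r < 1], and the frame is singular on the axis. *)
Lemma segint_ge0 f a b : continuous f -> (forall x, a < x < b -> 0 <= f x) ->
  0 <= segint a b f.
Proof.
move=> cf f0; rewrite /segint.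
have if_ : mu.-integrable `]a, b[ (EFin \o f).
  apply: integrableS (continuous_segment_integrable a b cf) => //.
  exact: subset_itv_oo_cc.
have ifc : mu.-integrable `[a, b[ (EFin \o f).
  apply: integrableS (continuous_segment_integrable a b cf) => //.
  exact: subset_itv_co_cc.
rewrite -Rintegral_itv_bndo_bndc// -Rintegral_itv_obnd_cbnd//.
by apply: Rintegral_ge0 => x /=; rewrite in_itv/=; exact: f0.
Qed.

Lemma segint_norm_le f a b k : a <= b -> continuous f ->
  (forall x, a <= x <= b -> `|f x| <= k) -> `|segint a b f| <= k * (b - a).
Proof.
move=> ab cf fk; rewrite -segint_cst//.
apply: le_trans (le_normr_Rintegral _ (continuous_segment_integrable a b cf)) _ => //.
apply: le_Rintegral => //.
  by apply: (@continuous_segment_integrable (fun x => `|f x|)) => x;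
    apply: continuous_comp; [exact: cf|exact: norm_continuous].
by apply: (@continuous_segment_integrable (fun=> k)) => x; exact: cvg_cst.
Qed.

Lemma segint_FTC (F : R -> R) f a b : a <= b ->
  (forall x, a <= x <= b -> is_derive x 1 F (f x)) -> continuous f ->
  segint a b f = F b - F a.
Proof.
rewrite le_eqVlt => /predU1P[->|ab] dF cf.
  by rewrite subrr /segint set_itv1 Rintegral_set1.
have cF x : a <= x <= b -> {for x, continuous F}.
  move=> /dF [dFx _]; apply: differentiable_continuous.
  exact/derivable1_diffP.
rewrite /segint /Rintegral (@continuous_FTC2 _ f F)//.
- exact: continuous_subspaceT.
- split.
  + by move=> x /[!in_itv]/= /andP[/ltW ax /ltW xb]; have [] := dF x; rewrite ?ax.
  + by apply: cvg_at_right_filter; apply: cF; rewrite lexx ltW.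
  + by apply: cvg_at_left_filter; apply: cF; rewrite lexx ltW.
- move=> x /[!in_itv]/= /andP[/ltW ax /ltW xb].
  by rewrite derive1E; have [|_ ->] := dF x; rewrite ?ax.
Qed.

(** Since [[a, b]] is compact, joint continuity at the points [(t0, s)] makes [f t] uniformly close
    to [f t0] on it for [t] near [t0]. *)
Lemma continuous_segint (T : topologicalType) (f : T -> R -> R) a b :
  continuous (fun p : T * R => f p.1 p.2) ->
  continuous (fun t => segint a b (f t)).
Proof.
move=> cf t0.
have cft t : continuous (f t).
  apply: (continuous_fcomp (continuous_pairf _ _) cf) => [x|x]; first exact: cvg_cst.
  exact: cvg_id.
have [ab|ba] := leP a b; last first.
  rewrite (_ : (fun t => _) = cst 0); first exact: cvg_cst.
  apply/funext => t; rewrite /segint set_itv_ge ?Rintegral_set0//.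
  by rewrite bnd_simp -ltNge.
apply/cvgrPdist_le => e e0.
(* The summand 1 keeps the denominator positive when [a = b]. *)
have e'0 : 0 < e / (b - a + 1) by rewrite divr_gt0// ltr_wpDl// subr_ge0.
have /compact_near_coveringP ncov := @segment_compact R a b.
have /= : \forall t \near t0, `[a, b]%classic `<=` (fun s => `|f t0 s - f t s| <= e / (b - a + 1)).
  apply: ncov => s _.
  have e''0 : 0 < e / (b - a + 1) / 2 by rewrite divr_gt0.
  have := cf (t0, s); rewrite /continuous_at/= => /cvgrPdist_le /(_ _ e''0) cfe.
  case: cfe => [[A B] /= [A0 B0] AB].
  exists (B, A) => //= -[x t] /= [Bx At].
  have xe : `|f t0 s - f t x| <= e / (b - a + 1) / 2 by apply: (AB (t, x)).
  have xe' : `|f t0 s - f t0 x| <= e / (b - a + 1) / 2.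
    by apply: (AB (t0, x)); split => //=; exact: nbhs_singleton.
  rewrite (_ : _ - _ = (f t0 s - f t x) - (f t0 s - f t0 x)); last by ring.
  by rewrite (le_trans (ler_normB _ _))// [leRHS]splitr lerD.
apply: filterS => t st.
rewrite -segintB//.
apply: (@le_trans _ _ (e / (b - a + 1) * (b - a))).
  apply: segint_norm_le => // x; apply: continuousB; exact: cft.
rewrite -mulrA ger_pMr// mulrC ler_pdivrMr ?mul1r; last by rewrite ltr_wpDl// subr_ge0.
by rewrite lerDl.
Qed.

(** Domination is by a constant: the maximum of [|df|] over the compact rectangle with sides
    [[u, v]] and [[a, b]]. *)
Lemma segint_Leibniz (f df : R -> R -> R) a b u v (t0 : R) : u < t0 < v ->
  (forall t, continuous (f t)) ->
  continuous (fun p : R * R => df p.1 p.2) ->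
  (forall t s, u < t < v -> is_derive t 1 (f ^~ s) (df t s)) ->
  is_derive t0 1 (fun t => segint a b (f t)) (segint a b (df t0)).
Proof.
move=> /andP[ut tv] cf cdf fdf.
have [ab|ba] := leP a b; last first.
  have seg0 g : segint a b g = 0.
    by rewrite /segint set_itv_ge ?Rintegral_set0// bnd_simp -ltNge.
  have -> : (fun t => segint a b (f t)) = cst 0 by apply/funext => t; rewrite seg0.
  by rewrite seg0; exact: is_derive_cst.
pose K := (`[u, v] `*` `[a, b])%classic.
have K0 : K !=set0.
  by exists (t0, a); split; rewrite /= in_itv/= ?lexx ?ab// !ltW.
have cK : compact K by apply: compact_setX; exact: segment_compact.
have /(compact_EVT_max K0 cK)[c _ cmax] :
    {within K, continuous (fun p => `|df p.1 p.2|)}.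
  apply: continuous_subspaceT; apply: continuous_fcomp cdf _.
  exact: norm_continuous.
have It0 : `]u, v[%classic t0 by rewrite /= in_itv/= ut.
have intf t : `]u, v[%classic t -> mu.-integrable `[a, b] (EFin \o f t).
  by move=> _; exact: continuous_segment_integrable.
have derf t s : `]u, v[%classic t -> `[a, b]%classic s -> derivable (f ^~ s) t 1.
  by move=> /= /[!in_itv]/= uv _; have [] := fdf _ s uv.
have d1E t s : u < t < v -> partial1of2 f t s = df t s.
  by move=> uv; rewrite partial1of2E; have [_ ->] := fdf _ s uv.
have intG : mu.-integrable `[a, b] (EFin \o cst `|df c.1 c.2|).
  by apply: (@continuous_segment_integrable (fun=> _)) => x; exact: cvg_cst.
have Gub t s : `]u, v[%classic t -> `[a, b]%classic s ->
    `|partial1of2 f t s| <= cst `|df c.1 c.2| s.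
  move=> /= /[!in_itv]/= uv sab; rewrite d1E//; apply: (cmax (t, s)).
  by rewrite inE; split; rewrite /= in_itv//=; case/andP: uv => ? ?; rewrite !ltW.
have G0 : forall s : R, 0 <= cst `|df c.1 c.2| s by move=> s /=.
have mab : measurable (`[a, b]%classic : set R) by [].
apply: DeriveDef.
  exact: (@derivable_under_integral _ _ _ mu f _ mab _ _ _ It0 intf derf _ G0 intG Gub).
rewrite -derive1E (@differentiation_under_integral _ _ _ mu f _ mab _ _ _ It0 intf derf _ G0 intG Gub).
by apply: eq_Rintegral => s _; rewrite d1E// ut.
Qed.

(** For continuous [f] this is one-variable calculus. With [G ^~ s] a primitive of [f s],
    differentiation under the integral sign gives the derivative of [segint a b (G t)] in [t]; the
    fundamental theorem is applied to this function and to each [G ^~ s]. *)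
Lemma segint_Fubini (f : R -> R -> R) a b c d : a <= b -> c <= d ->
  continuous (fun p : R * R => f p.1 p.2) ->
  segint c d (fun t => segint a b (fun s => f s t)) =
  segint a b (fun s => segint c d (f s)).
Proof.
move=> ab cd cf.
have cfs s : continuous (f s).
  apply: (continuous_fcomp (continuous_pairf _ _) cf) => [x|x]; first exact: cvg_cst.
  exact: cvg_id.
have cfT : continuous (fun p : R * R => f p.2 p.1).
  apply: (continuous_fcomp (continuous_pairf _ _) cf) => [x|x]; first exact: cvg_snd.
  exact: cvg_fst.
(* Starting at [c - 1], and allowing [t] up to [d + 1], makes all of [[c, d]] interior, so two-sided
   derivatives exist at [c] and [d] as well. *)
pose G t s := segint (c - 1) t (f s).
have cG t : continuous (G t) by exact: continuous_segint.
have dG t s : c - 1 < t < d + 1 -> is_derive t 1 (G ^~ s) (f s t).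
  move=> /andP[ct td].
  have [dGt GE] : derivable (G ^~ s) t 1 /\ derive1 (G ^~ s) t = f s t.
    by apply: (@continuous_FTC1_closed _ (f s) (c - 1) t (d + 1) td
      (continuous_segment_integrable _ _ (cfs s)) ct (cfs s t)).
  by split; [exact: dGt|rewrite -derive1E; exact: GE].
have cdt t : c <= t <= d -> c - 1 < t < d + 1.
  by move=> /andP[ct td]; apply/andP; split; lra.
have dGI t : c <= t <= d ->
    is_derive t 1 (fun t => segint a b (G t)) (segint a b (fun s => f s t)).
  move=> /cdt tcd.
  exact: (@segint_Leibniz G (fun t s => f s t) _ _ _ _ _ tcd cG cfT (fun t s => @dG t s)).
have cI : continuous (fun t => segint a b (fun s => f s t)).
  exact: (@continuous_segint R (fun t s => f s t)).
rewrite (segint_FTC cd dGI cI) -segintB; [|exact: cG|exact: cG].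
apply: eq_segint => s _.
have dGs t : c <= t <= d -> is_derive t 1 (G ^~ s) (f s t) by move=> /cdt; exact: dG.
by rewrite (segint_FTC cd dGs (cfs s)).
Qed.

End SegmentIntegral.

(** * Differential calculus on R^3 *)

Definition iz : 'I_3 := @Ordinal 3 2 isT.

Lemma ord3P (i : 'I_3) : [\/ i = ix, i = iy | i = iz].
Proof.
case: i => [[|[|[|//]]] lti]; [constructor 1|constructor 2|constructor 3]; exact: val_inj.
Qed.

Lemma sum_ord3 (V : nmodType) (F : 'I_3 -> V) : \sum_(i < 3) F i = F ix + F iy + F iz.
Proof.
rewrite !big_ord_recl big_ord0 addr0 addrA.
by congr (F _ + F _ + F _); exact: val_inj.
Qed.

Section Space.
Context {R : realType}.
Notation point := 'rV[R]_3.
Implicit Types (p v w : point) (f g : point -> R) (V : point -> point).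

Lemma vec3E (x y z : R) :
  (vec3 x y z 0 ix = x) * (vec3 x y z 0 iy = y) * (vec3 x y z 0 iz = z).
Proof. by rewrite !mxE. Qed.

Lemma vec3_eta p : p = vec3 (p 0 ix) (p 0 iy) (p 0 iz).
Proof. by apply/rowP => i; case: (ord3P i) => ->; rewrite vec3E. Qed.

Lemma point_ext p v : p 0 ix = v 0 ix -> p 0 iy = v 0 iy -> p 0 iz = v 0 iz -> p = v.
Proof. by move=> e1 e2 e3; rewrite [p]vec3_eta e1 e2 e3 -vec3_eta. Qed.

Lemma dotE v w : dot v w = v 0 ix * w 0 ix + v 0 iy * w 0 iy + v 0 iz * w 0 iz.
Proof. by rewrite /dot sum_ord3. Qed.

Lemma dotC v w : dot v w = dot w v.
Proof. by rewrite !dotE; ring. Qed.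

Lemma dot_is_linear v : linear (dot v : point -> R).
Proof. by move=> k w w'; rewrite !dotE !mxE /GRing.scale/=; ring. Qed.

HB.instance Definition _ v :=
  GRing.isLinear.Build R point R *:%R (dot v) (dot_is_linear v).

Lemma dotDl (a b c : point) : dot (a + b) c = dot a c + dot b c.
Proof. by rewrite !(dotC _ c) linearD. Qed.

Lemma dotBl (a b c : point) : dot (a - b) c = dot a c - dot b c.
Proof. by rewrite !(dotC _ c) linearB. Qed.

Lemma dotZl k (a c : point) : dot (k *: a) c = k * dot a c.
Proof. by rewrite !(dotC _ c) linearZ. Qed.

Lemma ler_coord_norm p i : `|p 0 i| <= `|p|.
Proof.
rewrite [leRHS]/Num.Def.normr/= mx_normrE.
exact: (le_bigmax _ (fun ij : 'I_1 * 'I_3 => `|p ij.1 ij.2|) (0, i)).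
Qed.

(** The norm of ['rV[R]_3] is the maximum norm, whence the factor 3. *)
Lemma ler_norm_dot v w : `|dot v w| <= 3 * `|v| * `|w|.
Proof.
have vw i : `|v 0 i * w 0 i| <= `|v| * `|w|.
  by rewrite normrM ler_pM// ler_coord_norm.
rewrite dotE; apply: le_trans (ler_normD _ _) _.
have := ler_normD (v 0 ix * w 0 ix) (v 0 iy * w 0 iy).
have := vw ix; have := vw iy; have := vw iz; lra.
Qed.

Lemma continuous_coordrV i : continuous (fun p => p 0 i).
Proof. exact: coord_continuous. Qed.

Lemma continuous_addf (T : topologicalType) (f g : T -> R) :
  continuous f -> continuous g -> continuous (fun x => f x + g x).
Proof. by move=> cf cg x; apply: cvgD; [exact: cf|exact: cg]. Qed.

Lemma continuous_mulf (T : topologicalType) (f g : T -> R) :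
  continuous f -> continuous g -> continuous (fun x => f x * g x).
Proof. by move=> cf cg x; apply: cvgM; [exact: cf|exact: cg]. Qed.

Lemma continuous_dot (T : topologicalType) (V W : T -> point) :
  continuous V -> continuous W -> continuous (fun x => dot (V x) (W x)).
Proof.
move=> cV cW.
have -> : (fun x => dot (V x) (W x)) = (fun x => V x 0 ix * W x 0 ix +
  V x 0 iy * W x 0 iy + V x 0 iz * W x 0 iz) by apply/funext => x; rewrite dotE.
have cc i (U : T -> point) : continuous U -> continuous (fun x => U x 0 i).
  by move=> cU; exact: (continuous_fcomp cU (@continuous_coordrV i)).
by repeat apply: continuous_addf; apply: continuous_mulf; exact: cc.
Qed.

Lemma continuous_vec3 (T : topologicalType) (f g h : T -> R) :
  continuous f -> continuous g -> continuous h ->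
  continuous (fun t => vec3 (f t) (g t) (h t)).
Proof.
move=> cf cg ch t; apply/cvgrPdist_le => e e0.
have [] := (cf t, cg t, ch t) => -[/cvgrPdist_le/(_ e e0) + /cvgrPdist_le/(_ e e0) +] /cvgrPdist_le/(_ e e0).
apply: filterS3 => s sf sg sh.
rewrite [leLHS]/Num.Def.normr/= mx_normrE (bigmax_le _ (ltW e0))//= => -[i j] _ /=.
by rewrite ord1 {i}; case: (ord3P j) => ->; rewrite !mxE.
Qed.

(** The mean value theorem on the segment from [p] to [p + v] turns the remainder into the product
    of [G (t *: v + p) - G p] with [v], for some [t] in []0, 1[]. Continuity of [G] makes it small
    compared with [v]. *)
Lemma gateaux_differentiable f (G : point -> point) :
  (forall p v, is_derive p v f (dot (G p) v)) -> continuous G ->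
  forall p, differentiable f p.
Proof.
move=> df cG p; apply/diff_locallyP.
have cdot : continuous (dot (G p)).
  apply: (@continuous_dot _ (fun=> G p) id) => v; last exact: cvg_id.
  exact: cst_continuous.
(* By uniqueness of the differential, it is enough that [dot (G p)] gives a first-order expansion of
   [f] at [p]. *)
have := @diff_unique R point R f (dot (G p)) p cdot.
set P := (X in (X -> _) -> _) => fo; suff HP : P by rewrite (fo HP).
rewrite /P; apply/eqaddoP => e e0.
have e3 : 0 < e / 3 by rewrite divr_gt0.
have /cvgrPdist_le /(_ _ e3) /nbhs_normP[d /= d0 Gd] := cG p.
have : \forall v \near (0 : point), `|v| < d by exact: nbhs0_lt.
apply: filterS => v vd.
have dphi (t : R) : is_derive t 1 (fun t : R => f (t *: v + p)) (dot (G (t *: v + p)) v).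
  have [dfv <-] := df (t *: v + p) v.
  have E : (fun h : R => h^-1 *: (((fun t : R => f (t *: v + p)) \o shift t) (h *: 1) - f (t *: v + p)))
         = (fun h : R => h^-1 *: ((f \o shift (t *: v + p)) (h *: v) - f (t *: v + p))).
    apply/funext => h /=; congr (_ *: (f _ - _)).
    by rewrite [h *: 1]mulr1 scalerDl addrA.
  by apply: DeriveDef; rewrite /derivable /derive E.
have [|t /= t01 mvt] := @MVT R (fun t : R => f (t *: v + p)) (fun t => dot (G (t *: v + p)) v) 0 1 ltr01 (fun t _ => dphi t).
  by apply: derivable_within_continuous => t _; have [] := dphi t.
move: mvt; rewrite scale1r scale0r add0r subr0 mulr1 => mvt.
have -> : (f \o shift p - (cst (f p) + dot (G p))) v = dot (G (t *: v + p) - G p) v.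
  rewrite -[LHS]/(f (v + p) - (f p + dot (G p) v)) opprD addrA mvt.
  by rewrite !dotE !mxE; ring.
apply: le_trans (ler_norm_dot _ _) _.
rewrite ler_wpM2r// -ler_pdivlMl// mulrC.
rewrite distrC; apply: (Gd (t *: v + p)) => /=.
rewrite opprD addrCA subrr addr0 normrN normrZ; move: t01; rewrite in_itv/= => /andP[t0 t1].
by rewrite gtr0_norm// (le_lt_trans _ vd)// ler_piMl// ltW.
Qed.

Lemma derive_dot_grad f p v : differentiable f p -> 'D_v f p = dot (grad f p) v.
Proof.
move=> df; rewrite deriveE// [in LHS](row_sum_delta v) linear_sum sum_ord3.
rewrite !linearZ /= dotE !mxE /partial !deriveE//.
by congr (_ + _ + _); exact: mulrC.
Qed.

Lemma is_derive_along f (c : R -> point) (t : R) v :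
  differentiable f (c t) -> is_derive t 1 c v ->
  is_derive t 1 (f \o c) (dot (grad f (c t)) v).
Proof.
move=> df [/derivable1_diffP dc <-]; have dfc := differentiable_comp dc df.
apply: DeriveDef; first exact: diff_derivable.
by rewrite [LHS]deriveE// diff_comp//= -deriveE// derive_dot_grad// deriveE.
Qed.

Lemma is_derive_vec3 (x y z : R -> R) (t dx dy dz : R) :
  is_derive t 1 x dx -> is_derive t 1 y dy -> is_derive t 1 z dz ->
  is_derive t 1 (fun t => vec3 (x t) (y t) (z t)) (vec3 dx dy dz).
Proof.
move=> [xt ex] [yt ey] [zt ez].
have coordE (i : 'I_1) j : (fun s => vec3 (x s) (y s) (z s) i j) = [:: x; y; z]`_j.
  by apply/funext => s; rewrite !mxE; case: (ord3P j) => ->.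
have dvec : derivable (fun t => vec3 (x t) (y t) (z t)) t 1.
  apply/derivable_mxP => i j; rewrite coordE.
  by case: (ord3P j) => -> /=; [exact: xt|exact: yt|exact: zt].
apply: DeriveDef => //; rewrite derive_mx//.
apply/rowP => j; rewrite !mxE coordE; case: (ord3P j) => -> /=; [exact: ex|exact: ey|exact: ez].
Qed.

Lemma differentiable_coordf V p j :
  differentiable V p -> differentiable (fun q => V q 0 j) p.
Proof.
move=> dV; apply: (@differentiable_comp _ _ _ _ V (fun M : point => M 0 j)) => //.
exact: differentiable_coord.
Qed.

Lemma derive_coord V p v j :
  differentiable V p -> ('D_v V p) 0 j = 'D_v (fun q => V q 0 j) p.
Proof. by move=> dV; rewrite derive_mx ?mxE//; exact: diff_derivable. Qed.

Lemma rV_coord_sum V : V = fun p => \sum_j V p 0 j *: delta_mx 0 j.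
Proof. by apply/funext => p; exact: row_sum_delta. Qed.

Lemma differentiable_vec V p :
  (forall j, differentiable (fun q => V q 0 j) p) -> differentiable V p.
Proof.
move=> dV; rewrite [V]rV_coord_sum.
have -> : (fun p => \sum_j V p 0 j *: delta_mx 0 j) =
   \sum_j (fun p => V p 0 j *: delta_mx 0 j :> point) by rewrite fct_sumE.
by apply: differentiable_sum => j; exact: differentiableZl.
Qed.

Lemma Ck_continuous (W : normedModType R) k (f : point -> W) : Ck k f -> continuous f.
Proof. by case: k => [//|k [df _]] p; exact: differentiable_continuous. Qed.

Lemma CkS (W : normedModType R) k (f : point -> W) : Ck k.+1 f -> Ck k f.
Proof.
elim: k f => [f fk|k IH f [df fk]]; first exact: Ck_continuous fk.
by split=> // i; exact: IH.
Qed.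

Lemma Ck_differentiable (W : normedModType R) k (f : point -> W) p :
  Ck k.+1 f -> differentiable f p.
Proof. by case. Qed.

Lemma Ck_partial (W : normedModType R) k i (f : point -> W) :
  Ck k.+1 f -> Ck k (partial i f).
Proof. by case=> _; exact. Qed.

Lemma Ck_cst (W : normedModType R) k (c : W) : Ck k (fun=> c : W).
Proof.
elim: k c => [|k IH] c /=; first by move=> p; exact: cst_continuous.
split=> [p|i]; first exact: differentiable_cst.
rewrite (_ : partial i _ = fun=> 0); first exact: IH.
by apply/funext => p; rewrite /partial derive_cst.
Qed.

Lemma CkD k f g : Ck k f -> Ck k g -> Ck k (fun p => f p + g p).
Proof.
elim: k f g => [|k IH] f g /=.
  exact: continuous_addf.
move=> [df fk] [dg gk]; split=> [p|i]; first exact: differentiableD.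
rewrite (_ : partial i _ = fun p => partial i f p + partial i g p); first exact: IH.
by apply/funext => p; rewrite /partial deriveD//; exact: diff_derivable.
Qed.

Lemma CkM k f g : Ck k f -> Ck k g -> Ck k (fun p => f p * g p).
Proof.
elim: k f g => [|k IH] f g.
  exact: continuous_mulf.
move=> fk gk; split=> [p|i].
  by apply: differentiableM; [exact: Ck_differentiable fk|exact: Ck_differentiable gk].
rewrite (_ : partial i _ = fun p => f p * partial i g p + g p * partial i f p).
  by apply: CkD; apply: IH; do ?[exact: CkS|exact: Ck_partial].
apply/funext => p; rewrite /partial deriveM//; apply: diff_derivable.
  exact: Ck_differentiable fk.
exact: Ck_differentiable gk.
Qed.

Lemma CkN k f : Ck k f -> Ck k (fun p => - f p).
Proof.
move=> fk; rewrite (_ : (fun p => - f p) = fun p => -1 * f p).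
  by apply: CkM => //; exact: Ck_cst.
by apply/funext => p; rewrite mulN1r.
Qed.

Lemma partial_coord i j p : partial i (fun q : point => q 0 j) p = (i == j)%:R.
Proof.
rewrite /partial; have := @derive_coord id p (delta_mx 0 i) j.
by rewrite derive_id !mxE eqxx/= eq_sym => <-//; exact: ex_diff.
Qed.

Lemma Ck_coord k j : Ck k (fun p : point => p 0 j).
Proof.
case: k => [|k] /=; first exact: continuous_coordrV.
split=> [p|i]; first exact: differentiable_coord.
have -> : partial i (fun p : point => p 0 j) = fun=> ((i == j)%:R : R).
  by apply/funext => p; rewrite partial_coord.
exact: Ck_cst.
Qed.

(** Sums and products are treated for scalar functions; this equivalence transfers the results to
    vector fields. *)
Lemma Ck_vecP k V : Ck k V <-> forall j, Ck k (fun p => V p 0 j).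
Proof.
split.
  elim: k V => [|k IH] V /=.
    by move=> cV j; exact: (continuous_fcomp cV (@continuous_coordrV j)).
  move=> [dV Vk] j; split=> [p|i]; first exact: differentiable_coordf.
  rewrite (_ : partial i _ = fun p => partial i V p 0 j); first exact: IH.
  by apply/funext => p; rewrite /partial derive_coord.
elim: k V => [|k IH] V /=.
  move=> cV; rewrite [V](_ : _ = fun p => vec3 (V p 0 ix) (V p 0 iy) (V p 0 iz)).
    exact: continuous_vec3.
  by apply/funext => p; exact: vec3_eta.
move=> Vk; have dV p : differentiable V p.
  by apply: differentiable_vec => j; exact: (Vk j).1.
split=> // i; apply: IH => j.
rewrite (_ : (fun p => _) = partial i (fun p => V p 0 j)); first exact: (Vk j).2.
by apply/funext => p; rewrite /partial derive_coord.
Qed.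

Lemma Ck_dot k V U : Ck k V -> Ck k U -> Ck k (fun p => dot (V p) (U p)).
Proof.
move=> /Ck_vecP Vk /Ck_vecP Uk.
have -> : (fun p => dot (V p) (U p)) = fun p => V p 0 ix * U p 0 ix +
  V p 0 iy * U p 0 iy + V p 0 iz * U p 0 iz by apply/funext => p; rewrite dotE.
by repeat apply: CkD; apply: CkM.
Qed.

Lemma Ck_grad k f : Ck k.+1 f -> Ck k (grad f).
Proof.
move=> fk; apply/Ck_vecP => j; rewrite (_ : (fun p => _) = partial j f).
  exact: Ck_partial.
by apply/funext => p; rewrite mxE.
Qed.

Lemma nabla_coord U V p j : differentiable V p ->
  nabla U V p 0 j = dot (grad (fun q => V q 0 j) p) (U p).
Proof.
by move=> dV; rewrite /nabla derive_coord// derive_dot_grad//; exact: differentiable_coordf.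
Qed.

Lemma Ck_nabla k U V : Ck k U -> Ck k.+1 V -> Ck k (nabla U V).
Proof.
move=> Uk Vk; apply/Ck_vecP => j.
rewrite (_ : (fun p => _) = fun p => dot (grad (fun q => V q 0 j) p) (U p)).
  by apply: Ck_dot => //; apply: Ck_grad; move/Ck_vecP: Vk; exact.
by apply/funext => p; apply: nabla_coord; exact: Ck_differentiable Vk.
Qed.

Lemma CkB_vec k U V : Ck k U -> Ck k V -> Ck k (U \- V).
Proof.
move=> /Ck_vecP Uk /Ck_vecP Vk; apply/Ck_vecP => j.
rewrite (_ : (fun p => _) = fun p => U p 0 j + - V p 0 j).
  by apply: CkD => //; exact: CkN.
by apply/funext => p; rewrite !mxE.
Qed.

Lemma CkD_vec k U V : Ck k U -> Ck k V -> Ck k (U \+ V).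
Proof.
move=> /Ck_vecP Uk /Ck_vecP Vk; apply/Ck_vecP => j.
rewrite (_ : (fun p => _) = fun p => U p 0 j + V p 0 j); first exact: CkD.
by apply/funext => p; rewrite !mxE.
Qed.

End Space.

(** * Divergence theorem in cylindrical coordinates *)

Section PolarIntegral.
Context {R : realType}.
Notation point := 'rV[R]_3.
Implicit Types (f g : R -> R -> R -> R) (p : point).

Definition continuous3 f := continuous (fun q : R * R * R => f q.1.1 q.1.2 q.2).

(** The factor [r] of the volume form is left to the integrand, where it turns divergence terms into
    exact derivatives. *)
Definition cylint f : R :=
  segint 0 (2 * pi) (fun z => segint 0 (2 * pi) (fun t => segint 0 1 (fun r => f r t z))).

Lemma continuous3_comp (T : topologicalType) f (a b c : T -> R) : continuous3 f ->
  continuous a -> continuous b -> continuous c ->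
  continuous (fun x => f (a x) (b x) (c x)).
Proof.
move=> cf ca cb cc.
exact: (continuous_fcomp (continuous_pairf (continuous_pairf ca cb) cc) cf).
Qed.

Let fst2_cont (T U V : topologicalType) : continuous (fun x : T * U * V => x.1.1).
Proof. exact: (continuous_fcomp (@continuous_fstf _ _) (@continuous_fstf _ _)). Qed.

Let snd2_cont (T U V : topologicalType) : continuous (fun x : T * U * V => x.1.2).
Proof. exact: (continuous_fcomp (@continuous_fstf _ _) (@continuous_sndf _ _)). Qed.

Lemma continuous3_1 f t z : continuous3 f -> continuous (fun r => f r t z).
Proof.
move=> cf; exact: (continuous3_comp cf
  (@continuous_idf R) (@continuous_cstf R R t) (@continuous_cstf R R z)).
Qed.

Lemma continuous3_2 f r z : continuous3 f -> continuous (fun t => f r t z).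
Proof.
move=> cf; exact: (continuous3_comp cf
  (@continuous_cstf R R r) (@continuous_idf R) (@continuous_cstf R R z)).
Qed.

Lemma continuous3_3 f r t : continuous3 f -> continuous (fun z => f r t z).
Proof.
move=> cf; exact: (continuous3_comp cf
  (@continuous_cstf R R r) (@continuous_cstf R R t) (@continuous_idf R)).
Qed.

Lemma continuous_cylint1 f : continuous3 f ->
  continuous (fun q : R * R => segint 0 1 (fun r => f r q.1 q.2)).
Proof.
move=> cf; apply: (@continuous_segint _ _ (fun q r => f r q.1 q.2)).
exact: (continuous3_comp cf (@continuous_sndf _ _) (@fst2_cont _ _ _) (@snd2_cont _ _ _)).
Qed.

Lemma continuous_cylint1t f z : continuous3 f ->
  continuous (fun t => segint 0 1 (fun r => f r t z)).
Proof.
move=> /continuous_cylint1 cf.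
exact: (continuous_fcomp (continuous_pairf (@continuous_idf R) (@continuous_cstf _ R z)) cf).
Qed.

Lemma continuous_cylint2 f : continuous3 f ->
  continuous (fun z => segint 0 (2 * pi) (fun t => segint 0 1 (fun r => f r t z))).
Proof.
move=> /continuous_cylint1 cf.
apply: (@continuous_segint _ _ (fun z t => segint 0 1 (fun r => f r t z))).
exact: (continuous_fcomp (continuous_pairf (@continuous_sndf _ _) (@continuous_fstf _ _)) cf).
Qed.

Lemma eq_cylint f g : (forall r t z, 0 <= r <= 1 -> f r t z = g r t z) ->
  cylint f = cylint g.
Proof.
move=> fg; apply: eq_segint => z _; apply: eq_segint => t _.
by apply: eq_segint => r; exact: fg.
Qed.

Lemma cylintD f g : continuous3 f -> continuous3 g ->
  cylint (fun r t z => f r t z + g r t z) = cylint f + cylint g.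
Proof.
move=> cf cg; rewrite /cylint -segintD; try exact: continuous_cylint2.
apply: eq_segint => z _; rewrite -segintD; try exact: continuous_cylint1t.
by apply: eq_segint => t _; rewrite -segintD//; exact: continuous3_1.
Qed.

Lemma cylintZ k f : continuous3 f -> cylint (fun r t z => k * f r t z) = k * cylint f.
Proof.
move=> cf; rewrite /cylint -segintZ; last exact: continuous_cylint2.
apply: eq_segint => z _; rewrite -segintZ; last exact: continuous_cylint1t.
by apply: eq_segint => t _; rewrite -segintZ//; exact: continuous3_1.
Qed.

Lemma cylint_ge0 f : continuous3 f -> (forall r t z, 0 < r < 1 -> 0 <= f r t z) ->
  0 <= cylint f.
Proof.
move=> cf f0; apply: segint_ge0 => [|z _]; first exact: continuous_cylint2.
apply: segint_ge0 => [|t _]; first exact: continuous_cylint1t.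
by apply: segint_ge0 => [|r]; [exact: continuous3_1|exact: f0].
Qed.

Lemma cylint_eq0_r f : (forall t z, segint 0 1 (fun r => f r t z) = 0) -> cylint f = 0.
Proof.
move=> f0; rewrite -[RHS](segint0 0 (2 * pi)); apply: eq_segint => z _.
by rewrite -[RHS](segint0 0 (2 * pi)); apply: eq_segint => t _.
Qed.

Let pi2_ge0 : 0 <= 2 * pi :> R.
Proof. by rewrite mulr_ge0// pi_ge0. Qed.

Lemma cylint_eq0_t f : continuous3 f ->
  (forall r z, 0 <= r <= 1 -> segint 0 (2 * pi) (fun t => f r t z) = 0) -> cylint f = 0.
Proof.
move=> cf f0; rewrite -[RHS](segint0 0 (2 * pi)); apply: eq_segint => z _.
rewrite (@segint_Fubini _ (fun r t => f r t z)) ?ler01//; last first.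
  exact: (continuous3_comp cf (@continuous_fstf _ _) (@continuous_sndf _ _) (@continuous_cstf _ R _)).
by rewrite -[RHS](segint0 0 1); apply: eq_segint => r; exact: f0.
Qed.

Lemma cylint_eq0_z f : continuous3 f ->
  (forall r t, 0 <= r <= 1 -> segint 0 (2 * pi) (fun z => f r t z) = 0) -> cylint f = 0.
Proof.
move=> cf f0; rewrite /cylint.
rewrite (@segint_Fubini _ (fun t z => segint 0 1 (fun r => f r t z))) //; last first.
  exact: continuous_cylint1.
rewrite -[RHS](segint0 0 (2 * pi)); apply: eq_segint => t _.
rewrite (@segint_Fubini _ (fun r z => f r t z)) ?ler01//; last first.
  exact: (continuous3_comp cf (@continuous_fstf _ _) (@continuous_cstf _ R _) (@continuous_sndf _ _)).
by rewrite -[RHS](segint0 0 1); apply: eq_segint => r; exact: f0.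
Qed.

Definition polar (r t z : R) : point := vec3 (r * cos t) (r * sin t) z.
Definition e_r (t : R) : point := vec3 (cos t) (sin t) 0.
Definition e_theta (t : R) : point := vec3 (- sin t) (cos t) 0.

Lemma torus_integralE (F : point -> R) :
  torus_integral F = cylint (fun r t z => F (polar r t z) * r).
Proof. by []. Qed.

Lemma cyl_radius_polar r t z : 0 <= r -> cyl_radius (polar r t z) = r.
Proof.
move=> r0; rewrite /cyl_radius /polar !vec3E.
have -> : (r * cos t) ^+ 2 + (r * sin t) ^+ 2 = r ^+ 2.
  by rewrite !exprMn -mulrDr cos2Dsin2 mulr1.
by rewrite sqrtr_sqr ger0_norm.
Qed.

Lemma solid_torus_polar r t z : 0 <= r <= 1 -> solid_torus (polar r t z).
Proof. by move=> /andP[r0 r1]; rewrite /solid_torus/= cyl_radius_polar. Qed.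

Lemma torus_boundary_polar t z : torus_boundary (polar 1 t z).
Proof. by rewrite /torus_boundary/= cyl_radius_polar. Qed.

Lemma outward_normal_polar r t z : outward_normal (polar r t z) = r *: e_r t.
Proof.
by apply: point_ext; rewrite /outward_normal /polar /e_r !(vec3E, mxE)//= ?mulr0//.
Qed.

Lemma rotE_polar r t z : rotE (polar r t z) = r *: e_theta t.
Proof.
by apply: point_ext; rewrite /rotE /polar /e_theta !(vec3E, mxE)//= ?mulr0// mulrN.
Qed.

Lemma is_derive_addf (f g : R -> R) (x df dg : R) :
  is_derive x 1 f df -> is_derive x 1 g dg ->
  is_derive x 1 (fun x => f x + g x) (df + dg).
Proof. by move=> hf hg; exact: is_deriveD. Qed.

Lemma is_derive_mulf (f g : R -> R) (x df dg : R) :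
  is_derive x 1 f df -> is_derive x 1 g dg ->
  is_derive x 1 (fun x => f x * g x) (f x * dg + g x * df).
Proof. by move=> hf hg; exact: is_deriveM. Qed.

Lemma is_derive_mulc (f : R -> R) (k x df : R) :
  is_derive x 1 f df -> is_derive x 1 (fun x => k * f x) (k * df).
Proof. by move=> hf; exact: is_deriveZ. Qed.

Lemma is_derive_constf (k x : R) : is_derive x 1 (fun _ : R => k) 0.
Proof. exact: (is_derive_cst k x 1). Qed.

Lemma is_derive_polar_r (r t z : R) : is_derive r 1 (fun r => polar r t z) (e_r t).
Proof.
apply: is_derive_vec3.
- under eq_fun do rewrite mulrC.
  by rewrite -[X in is_derive _ _ _ X]mulr1; exact: is_derive_mulc.
- under eq_fun do rewrite mulrC.
  by rewrite -[X in is_derive _ _ _ X]mulr1; exact: is_derive_mulc.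
Qed.

Lemma is_derive_polar_t (r t z : R) :
  is_derive t 1 (fun t => polar r t z) (r *: e_theta t).
Proof.
have -> : r *: e_theta t = vec3 (r * - sin t) (r * cos t) 0.
  by apply: point_ext; rewrite /e_theta !(vec3E, mxE)//= mulr0.
by apply: is_derive_vec3; exact: is_derive_mulc.
Qed.

Lemma is_derive_polar_z (r t z : R) :
  is_derive z 1 (fun z => polar r t z) (vec3 0 0 1).
Proof. exact: is_derive_vec3. Qed.

Lemma continuous_polar : continuous (fun q : R * R * R => polar q.1.1 q.1.2 q.2).
Proof.
apply: continuous_vec3; last exact: continuous_sndf.
- apply: continuous_mulf; first exact: fst2_cont.
  exact: (continuous_fcomp (@snd2_cont _ _ _) (@continuous_cos R)).
- apply: continuous_mulf; first exact: fst2_cont.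
  exact: (continuous_fcomp (@snd2_cont _ _ _) (@continuous_sin R)).
Qed.

Lemma continuous3_polar (F : point -> R) : continuous F ->
  continuous3 (fun r t z => F (polar r t z)).
Proof. exact: (continuous_fcomp continuous_polar). Qed.

Lemma continuous3_e_r : continuous (fun q : R * R * R => e_r q.1.2).
Proof.
apply: continuous_vec3; last exact: continuous_cstf.
- exact: (continuous_fcomp (@snd2_cont _ _ _) (@continuous_cos R)).
- exact: (continuous_fcomp (@snd2_cont _ _ _) (@continuous_sin R)).
Qed.

Lemma continuous3_e_theta : continuous (fun q : R * R * R => e_theta q.1.2).
Proof.
apply: continuous_vec3; last exact: continuous_cstf.
- apply: (continuous_fcomp (continuous_fcomp (@snd2_cont _ _ _) (@continuous_sin R))).
  exact: opp_continuous.
- exact: (continuous_fcomp (@snd2_cont _ _ _) (@continuous_cos R)).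
Qed.

Lemma continuous3_r : continuous3 (fun r _ _ => r).
Proof. exact: fst2_cont. Qed.

Lemma continuous3M f g : continuous3 f -> continuous3 g ->
  continuous3 (fun r t z => f r t z * g r t z).
Proof. exact: continuous_mulf. Qed.

Lemma continuous3D f g : continuous3 f -> continuous3 g ->
  continuous3 (fun r t z => f r t z + g r t z).
Proof. exact: continuous_addf. Qed.

Lemma continuous3_dot_polar (V : point -> point) (e : R -> R -> R -> point) :
  continuous V -> continuous (fun q : R * R * R => e q.1.1 q.1.2 q.2) ->
  continuous3 (fun r t z => dot (V (polar r t z)) (e r t z)).
Proof.
by move=> cV ce; apply: continuous_dot ce; exact: (continuous_fcomp continuous_polar).
Qed.

Lemma torus_integralD (F G : point -> R) : continuous F -> continuous G ->
  torus_integral (fun p => F p + G p) = torus_integral F + torus_integral G.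
Proof.
move=> cF cG; rewrite !torus_integralE -cylintD.
- by apply: eq_cylint => r t z _; rewrite mulrDl.
- by apply: continuous3M; [exact: continuous3_polar|exact: continuous3_r].
- by apply: continuous3M; [exact: continuous3_polar|exact: continuous3_r].
Qed.

Lemma torus_integralZ k (F : point -> R) : continuous F ->
  torus_integral (fun p => k * F p) = k * torus_integral F.
Proof.
move=> cF; rewrite !torus_integralE -cylintZ.
- by apply: eq_cylint => r t z _; rewrite mulrA.
- by apply: continuous3M; [exact: continuous3_polar|exact: continuous3_r].
Qed.

Lemma eq_torus_integral (F G : point -> R) :
  (forall p, solid_torus p -> F p = G p) -> torus_integral F = torus_integral G.
Proof.
move=> FG; rewrite !torus_integralE; apply: eq_cylint => r t z r01.
by rewrite FG//; exact: solid_torus_polar.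
Qed.

Lemma torus_integral_ge0 (F : point -> R) : continuous F ->
  (forall p, solid_torus p -> 0 <= F p) -> 0 <= torus_integral F.
Proof.
move=> cF F0; rewrite torus_integralE; apply: cylint_ge0.
  by apply: continuous3M; [exact: continuous3_polar|exact: continuous3_r].
move=> r t z /andP[r0 r1]; rewrite mulr_ge0 ?(ltW r0)//.
by apply/F0/solid_torus_polar; rewrite !ltW.
Qed.

Lemma polar_2pi r z : polar r (2 * pi) z = polar r 0 z.
Proof. by rewrite /polar mulr_natl cos2pi sin2pi cos0 sin0. Qed.

Lemma e_theta_2pi : e_theta (2 * pi) = e_theta 0.
Proof. by rewrite /e_theta mulr_natl cos2pi sin2pi cos0 sin0. Qed.

Lemma polar_z2pi r t z : polar r t (z + 2 * pi) = polar r t z + vec3 0 0 (2 * pi).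
Proof. by apply: point_ext; rewrite !(vec3E, mxE)//= addr0. Qed.

Lemma divergenceE (V : point -> point) p : differentiable V p ->
  divergence V p = partial ix (fun q => V q 0 ix) p + partial iy (fun q => V q 0 iy) p +
    partial iz (fun q => V q 0 iz) p.
Proof.
by move=> dV; rewrite /divergence sum_ord3; congr (_ + _ + _); exact: derive_coord.
Qed.

Lemma is_derive_coordf (A : R -> point) (t : R) a j :
  is_derive t 1 A a -> is_derive t 1 (fun t => A t 0 j) (a 0 j).
Proof.
move=> [dA <-]; split; first by move/derivable_mxP: dA; exact.
by rewrite derive_mx// mxE.
Qed.

Lemma is_derive_dot (A B : R -> point) (t : R) a b :
  is_derive t 1 A a -> is_derive t 1 B b ->
  is_derive t 1 (fun t => dot (A t) (B t)) (dot a (B t) + dot (A t) b).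
Proof.
move=> dA dB; have dM j := is_derive_mulf (is_derive_coordf j dA) (is_derive_coordf j dB).
have -> : (fun t => dot (A t) (B t)) = fun t => A t 0 ix * B t 0 ix +
  A t 0 iy * B t 0 iy + A t 0 iz * B t 0 iz by apply/funext => s; rewrite dotE.
have := is_derive_addf (is_derive_addf (dM ix) (dM iy)) (dM iz).
congr is_derive; rewrite !dotE; ring.
Qed.

Lemma is_derive_e_theta (t : R) : is_derive t 1 e_theta (- e_r t).
Proof.
have -> : - e_r t = vec3 (- cos t) (- sin t) 0.
  by apply: point_ext; rewrite !(vec3E, mxE)//= oppr0.
by apply: is_derive_vec3.
Qed.

(** The derivative of [V] in a form that is linear in [v] by construction and visibly continuous in
    [p] and [v] for a C^1 field. *)
Definition jacob (V : point -> point) p v : point :=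
  vec3 (dot (grad (fun q => V q 0 ix) p) v) (dot (grad (fun q => V q 0 iy) p) v)
    (dot (grad (fun q => V q 0 iz) p) v).

Lemma jacobE (V : point -> point) p v : differentiable V p -> 'D_v V p = jacob V p v.
Proof.
move=> dV; apply: point_ext; rewrite derive_coord// /jacob vec3E derive_dot_grad//;
  exact: differentiable_coordf.
Qed.

Lemma jacobZ (V : point -> point) p k v : jacob V p (k *: v) = k *: jacob V p v.
Proof. by apply: point_ext; rewrite !(mxE, vec3E)/= linearZ. Qed.

(** The trace of the Jacobian can be taken in any orthonormal basis; [t] need not be the angle of
    [p]. *)
Lemma divergence_frame (V : point -> point) p t : differentiable V p -> divergence V p =
  dot (jacob V p (e_r t)) (e_r t) + dot (jacob V p (e_theta t)) (e_theta t) +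
  jacob V p (vec3 0 0 1) 0 iz.
Proof.
move=> dV; rewrite (divergenceE dV).
have pg j : partial j (fun q => V q 0 j) p = grad (fun q => V q 0 j) p 0 j by rewrite mxE.
rewrite !pg /jacob; move: (grad _ p) (grad _ p) (grad _ p) => g1 g2 g3.
rewrite /e_r /e_theta !dotE !(vec3E _ _ _) -[X in X + _ = _]mulr1.
by rewrite -[X in _ * X + _ = _](cos2Dsin2 t) !expr2; ring.
Qed.

Lemma is_derive_along_vec (V : point -> point) (c : R -> point) (x : R) v :
  differentiable V (c x) -> is_derive x 1 c v ->
  is_derive x 1 (fun x => V (c x)) (jacob V (c x) v).
Proof.
move=> dV dc.
have -> : (fun x => V (c x)) = fun x => vec3 (V (c x) 0 ix) (V (c x) 0 iy) (V (c x) 0 iz).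
  by apply/funext => y; exact: vec3_eta.
apply: is_derive_vec3.
- exact: (is_derive_along (differentiable_coordf ix dV) dc).
- exact: (is_derive_along (differentiable_coordf iy dV) dc).
- exact: (is_derive_along (differentiable_coordf iz dV) dc).
Qed.

Lemma continuous3_jacob (V : point -> point) (e : R -> R -> R -> point) :
  Ck 1 V -> continuous (fun q : R * R * R => e q.1.1 q.1.2 q.2) ->
  continuous (fun q : R * R * R => jacob V (polar q.1.1 q.1.2 q.2) (e q.1.1 q.1.2 q.2)).
Proof.
move=> V1 ce.
have cg j : continuous (grad (fun q => V q 0 j)).
  by apply: (@Ck_continuous _ _ 0); apply: Ck_grad; move/Ck_vecP: V1; exact.
by apply: continuous_vec3; apply: continuous_dot ce;
  exact: (continuous_fcomp continuous_polar).
Qed.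

(* r div V = d_r (r V_r) + d_theta V_theta + d_z (r V_z) *)
Lemma gauss_torus (V : point -> point) : Ck 1 V -> z_periodic V ->
  (forall p, torus_boundary p -> dot (V p) (outward_normal p) = 0) ->
  torus_integral (divergence V) = 0.
Proof.
move=> V1 perV Vn.
have dV p : differentiable V p by exact: Ck_differentiable V1.
have cV : continuous V by exact: Ck_continuous V1.
pose h1 r t z := dot (V (polar r t z)) (e_r t) +
  r * dot (jacob V (polar r t z) (e_r t)) (e_r t).
(* The term [- V_r] comes from the derivative of [e_theta] and cancels the [V_r] that the product
   rule contributes to [h1]. *)
pose h2 r t z := dot (jacob V (polar r t z) (r *: e_theta t)) (e_theta t) +
  - dot (V (polar r t z)) (e_r t).
pose h3 r t z := r * jacob V (polar r t z) (vec3 0 0 1) 0 iz.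
have cre : continuous (fun q : R * R * R => q.1.1 *: e_theta q.1.2).
  have -> : (fun q : R * R * R => q.1.1 *: e_theta q.1.2) = fun q =>
      vec3 (q.1.1 * e_theta q.1.2 0 ix) (q.1.1 * e_theta q.1.2 0 iy) (q.1.1 * e_theta q.1.2 0 iz).
    by apply/funext => q; apply: point_ext; rewrite !(vec3E, mxE).
  by apply: continuous_vec3; apply: continuous_mulf continuous3_r _;
    exact: (continuous_fcomp continuous3_e_theta (@continuous_coordrV _ _)).
have cVP := continuous_fcomp continuous_polar cV.
have c1 : continuous3 h1.
  apply: continuous3D; first exact: (continuous_dot cVP continuous3_e_r).
  apply: continuous3M; first exact: continuous3_r.
  apply: continuous_dot continuous3_e_r.
  exact: (continuous3_jacob (e := fun _ t _ => e_r t) V1 continuous3_e_r).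
have c2 : continuous3 h2.
  apply: continuous3D; last first.
    apply: (continuous_fcomp (continuous_dot cVP continuous3_e_r)).
    exact: opp_continuous.
  apply: continuous_dot continuous3_e_theta.
  exact: (continuous3_jacob (e := fun r t _ => r *: e_theta t) V1 cre).
have c3 : continuous3 h3.
  apply: continuous3M; first exact: continuous3_r.
  apply: (continuous_fcomp _ (@continuous_coordrV R iz)).
  by apply: (continuous3_jacob (e := fun _ _ _ => vec3 0 0 1) V1); exact: cst_continuous.
rewrite torus_integralE (_ : cylint _ = cylint (fun r t z => h1 r t z + h2 r t z + h3 r t z)).
  rewrite (cylintD (continuous3D c1 c2) c3) (cylintD c1 c2).
  have -> : cylint h3 = 0.
    apply: cylint_eq0_z => // r t r01.
    have dh z : 0 <= z <= 2 * pi ->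
        is_derive z 1 (fun z => r * V (polar r t z) 0 iz) (h3 r t z).
      move=> _; have := is_derive_along_vec (dV _) (is_derive_polar_z r t z).
      by move=> /(is_derive_coordf iz); exact: is_derive_mulc.
    rewrite (segint_FTC pi2_ge0 dh); last exact: (@continuous3_3 h3 r t c3).
    by rewrite -(add0r (2 * pi)) polar_z2pi perV subrr.
  have -> : cylint h2 = 0.
    apply: cylint_eq0_t => // r z r01.
    have dh t : 0 <= t <= 2 * pi ->
        is_derive t 1 (fun t => dot (V (polar r t z)) (e_theta t)) (h2 r t z).
      move=> _; rewrite /h2 -linearN; apply: is_derive_dot (is_derive_e_theta t).
      exact: (is_derive_along_vec (dV _) (is_derive_polar_t r t z)).
    rewrite (segint_FTC pi2_ge0 dh); last exact: (@continuous3_2 h2 r z c2).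
    by rewrite polar_2pi e_theta_2pi subrr.
  rewrite !addr0; apply: cylint_eq0_r => t z.
    have dh (r : R) : 0 <= r <= 1 ->
        is_derive r 1 (fun r => r * dot (V (polar r t z)) (e_r t)) (h1 r t z).
      move=> _.
      have dD := is_derive_dot (is_derive_along_vec (dV _) (is_derive_polar_r r t z))
        (is_derive_cst (e_r t) r 1).
      have := is_derive_mulf (is_derive_id r 1) dD.
      by congr is_derive; rewrite /h1 linear0 addr0 mulr1 addrC.
    rewrite (segint_FTC ler01 dh); last exact: (@continuous3_1 h1 t z c1).
    (* The flux [r V_r] vanishes at [r = 1] by tangency and at [r = 0] by its factor [r]. *)
    have := Vn _ (torus_boundary_polar t z).
    by rewrite outward_normal_polar scale1r => ->; rewrite mulr0 mul0r subrr.
apply: eq_cylint => r t z _.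
rewrite (divergence_frame t (dV _)) /h1 /h2 /h3 jacobZ dotZl.
move: (dot (V _) _) (dot (jacob _ _ _) _) (dot (jacob _ _ _) _) (jacob _ _ _ _ _) => *.
ring.
Qed.

Lemma divergenceZ (q : point -> R) (V : point -> point) p :
  differentiable q p -> differentiable V p ->
  divergence (fun p => q p *: V p) p = dot (grad q p) (V p) + q p * divergence V p.
Proof.
move=> dq dV.
have dqV : differentiable (fun p => q p *: V p) p.
  apply: differentiable_vec => j.
  rewrite (_ : (fun p => _) = fun p => q p * V p 0 j); last by apply/funext => y; rewrite mxE.
  by apply: differentiableM => //; exact: differentiable_coordf.
rewrite !divergenceE//.
have E j : partial j (fun p => (q p *: V p) 0 j) p =
    q p * partial j (fun p => V p 0 j) p + V p 0 j * partial j q p.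
  rewrite (_ : (fun p => _) = fun p => q p * V p 0 j); last by apply/funext => y; rewrite mxE.
  by rewrite /partial deriveM//; apply: diff_derivable => //; exact: differentiable_coordf.
rewrite !E dotE !mxE; move: (partial ix q p) (partial iy q p) (partial iz q p) => *.
by move: (partial ix _ p) (partial iy _ p) (partial iz _ p) => *; ring.
Qed.

(** The divergence theorem for [q V], which is tangent to the boundary and whose divergence reduces
    to this integrand because [V] is divergence-free. *)
Lemma torus_integral_grad_dot (q : point -> R) (V : point -> point) :
  Ck 1 q -> Ck 1 V -> z_periodic q -> z_periodic V ->
  (forall p, solid_torus p -> divergence V p = 0) ->
  (forall p, torus_boundary p -> dot (V p) (outward_normal p) = 0) ->
  torus_integral (fun p => dot (grad q p) (V p)) = 0.
Proof.
move=> q1 V1 perq perV divV Vn.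
rewrite -[RHS](@gauss_torus (fun p => q p *: V p)).
- apply: eq_torus_integral => p Mp; rewrite divergenceZ ?divV ?mulr0 ?addr0//.
    exact: Ck_differentiable q1.
  exact: Ck_differentiable V1.
- apply/Ck_vecP => j.
  rewrite (_ : (fun p => _) = fun p => q p * V p 0 j); last by apply/funext => y; rewrite mxE.
  exact: (@CkM _ 1 q (fun p => V p 0 j) q1 ((Ck_vecP 1 V).1 V1 j)).
- by move=> p; rewrite perq perV.
- by move=> p /Vn; rewrite !dotE !mxE -!mulrA -!mulrDr => ->; rewrite mulr0.
Qed.

End PolarIntegral.

(** * Neumann problem for radial fields *)

Section RadialPotential.
Context {R : realType}.
Notation point := 'rV[R]_3.
Implicit Types (f : point -> R) (g : R -> R) (p v : point).

(** Forgetting [z] makes everything built from ray averages constant, hence periodic, in [z]. *)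
Definition disk_proj p : point := vec3 (p 0 ix) (p 0 iy) 0.

(* The weight g absorbs the factor s produced by each differentiation in p. *)
Definition ray_avg g f p : R := segint 0 1 (fun s => g s * f (s *: disk_proj p)).

Lemma dot_delta p i : dot p (delta_mx 0 i) = p 0 i.
Proof.
by rewrite dotE !mxE; case: (ord3P i) => -> /=; rewrite ?mulr1 ?mulr0 ?addr0 ?add0r.
Qed.

Lemma is_derive_line f p v (d : R) :
  is_derive (0 : R) 1 (fun h : R => f (h *: v + p)) d -> is_derive p v f d.
Proof.
have E : (fun h : R => h^-1 *: (((fun h : R => f (h *: v + p)) \o shift 0) (h *: 1) - f (0 *: v + p)))
       = (fun h : R => h^-1 *: ((f \o shift p) (h *: v) - f p)).
  by apply/funext => h /=; rewrite addr0 [h *: 1]mulr1 scale0r add0r.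
by move=> [df <-]; split; [exact/derivable1P|]; rewrite {1}/derive -E.
Qed.

Lemma continuous_scale_disk (T : topologicalType) (a : T -> R) (b : T -> point) :
  continuous a -> continuous b -> continuous (fun x => a x *: disk_proj (b x)).
Proof.
move=> ca cb.
have -> : (fun x => a x *: disk_proj (b x)) =
    fun x => vec3 (a x * b x 0 ix) (a x * b x 0 iy) 0.
  by apply/funext => x; apply: point_ext; rewrite !(vec3E, mxE)//= mulr0.
by apply: continuous_vec3; [| |exact: cst_continuous]; apply: continuous_mulf ca _;
  exact: (continuous_fcomp cb (@continuous_coordrV R _)).
Qed.

Lemma continuous_ray_avg g f : continuous g -> continuous f -> continuous (ray_avg g f).
Proof.
move=> cg cf; apply: (@continuous_segint _ _ (fun p s => g s * f (s *: disk_proj p))).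
apply: continuous_mulf; first exact: (continuous_fcomp (@continuous_sndf _ _) cg).
apply: (continuous_fcomp _ cf).
exact: (continuous_scale_disk (@continuous_sndf _ _) (@continuous_fstf _ _)).
Qed.

(** Differentiation under the integral sign along the line [h *: v + p]. The third component is 0
    because [disk_proj] forgets [z]. *)
Lemma is_derive_ray_avg g f p v : continuous g -> Ck 1 f ->
  is_derive p v (ray_avg g f)
    (dot (vec3 (ray_avg (fun s => s * g s) (partial ix f) p)
               (ray_avg (fun s => s * g s) (partial iy f) p) 0) v).
Proof.
move=> cg f1; apply: is_derive_line.
have cf := Ck_continuous f1.
have cp i : continuous (partial i f) by exact: (@Ck_continuous _ _ 0 _ (Ck_partial i f1)).
pose df (h s : R) := g s * dot (grad f (s *: disk_proj (h *: v + p))) (s *: disk_proj v).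
have cline : continuous (fun h : R => h *: v + p).
  have -> : (fun h : R => h *: v + p) =
     fun h => vec3 (h * v 0 ix + p 0 ix) (h * v 0 iy + p 0 iy) (h * v 0 iz + p 0 iz).
    by apply/funext => h; apply: point_ext; rewrite !(vec3E, mxE).
  by apply: continuous_vec3; apply: continuous_addf; try exact: cst_continuous;
    exact: (continuous_mulf (@continuous_idf R) (@continuous_cstf R R _)).
have cdf : continuous (fun q : R * R => df q.1 q.2).
  apply: continuous_mulf; first exact: (continuous_fcomp (@continuous_sndf _ _) cg).
  apply: continuous_dot.
    apply: continuous_fcomp (@Ck_continuous _ _ 0 _ (Ck_grad f1)).
    apply: (continuous_scale_disk (@continuous_sndf _ _)).
    exact: (continuous_fcomp (@continuous_fstf _ _) cline).
  by apply: (continuous_scale_disk (@continuous_sndf _ _)); exact: cst_continuous.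
have cs (w : point) : continuous (fun s : R => s *: disk_proj w).
  exact: (continuous_scale_disk (@continuous_idf R) (@continuous_cstf R point w)).
have cfh h : continuous (fun s => g s * f (s *: disk_proj (h *: v + p))).
  by apply: continuous_mulf => //; exact: (continuous_fcomp (cs _) cf).
have dfh (h s : R) : -1 < h < 1 ->
    is_derive h 1 (fun h => g s * f (s *: disk_proj (h *: v + p))) (df h s).
  move=> _; apply: is_derive_mulc.
  apply: (@is_derive_along _ f (fun h => s *: disk_proj (h *: v + p))).
    exact: Ck_differentiable f1.
  have -> : (fun h : R => s *: disk_proj (h *: v + p)) =
     fun h => vec3 (s * (v 0 ix * h + p 0 ix)) (s * (v 0 iy * h + p 0 iy)) 0.
    by apply/funext => k; apply: point_ext;
      rewrite !(vec3E, mxE)//= ?mulr0// (mulrC k).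
  have -> : s *: disk_proj v = vec3 (s * (v 0 ix * 1 + 0)) (s * (v 0 iy * 1 + 0)) 0.
    by apply: point_ext; rewrite !(vec3E, mxE)//= ?mulr0// mulr1 addr0.
  by apply: is_derive_vec3; apply: is_derive_mulc;
    apply: is_derive_addf (is_derive_constf _ _); apply: is_derive_mulc; exact: is_derive_id.
have lt01 : ((-1 : R) < 0) && ((0 : R) < 1) by rewrite ltrN10 ltr01.
have := segint_Leibniz 0 1 lt01 cfh cdf dfh.
have csp i : continuous (fun s : R => s * g s * partial i f (s *: disk_proj p)).
  apply: continuous_mulf; first exact: (continuous_mulf (@continuous_idf R)).
  exact: (continuous_fcomp (cs _) (cp i)).
have cvp i : continuous (fun s : R => v 0 i * (s * g s * partial i f (s *: disk_proj p))).
  by apply: continuous_mulf => //; exact: cst_continuous.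
suff <- : segint 0 1 (df 0) = dot (vec3 (ray_avg (fun s => s * g s) (partial ix f) p)
               (ray_avg (fun s => s * g s) (partial iy f) p) 0) v by [].
rewrite dotE (vec3E _ _ _).1.1 (vec3E _ _ _).1.2 (vec3E _ _ _).2 mul0r addr0.
rewrite [X in _ = X + _]mulrC [X in _ = _ + X]mulrC.
rewrite /ray_avg -(segintZ _ _ _ (csp ix)) -(segintZ _ _ _ (csp iy)).
rewrite -(segintD _ _ (cvp ix) (cvp iy)).
apply: eq_segint => s _.
have pg i x : partial i f x = grad f x 0 i by rewrite mxE.
rewrite !pg /df scale0r add0r; move: (grad f _) => gf.
by rewrite dotE !mxE /=; ring.
Qed.

(** The factor [(i != iz)%:R] keeps the vanishing [z]-derivative in the shape of a ray average, so
    that one formula serves the induction on the order of regularity. *)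
Lemma partial_ray_avg g f i : continuous g -> Ck 1 f ->
  partial i (ray_avg g f) = ray_avg (fun s => (i != iz)%:R * (s * g s)) (partial i f).
Proof.
move=> cg f1; apply/funext => p; rewrite /partial.
have [_ ->] := is_derive_ray_avg p (delta_mx 0 i) cg f1.
rewrite dot_delta; case: (ord3P i) => ->.
- by rewrite (vec3E _ _ _).1.1; apply: eq_segint => s _; rewrite mul1r.
- by rewrite (vec3E _ _ _).1.2; apply: eq_segint => s _; rewrite mul1r.
- rewrite (vec3E _ _ _).2 -[LHS](segint0 0 1).
  by apply: eq_segint => s _; rewrite !mul0r.
Qed.

(** The induction closes because partial derivatives of ray averages are ray averages, of a partial
    derivative of [f] and with a new weight; hence both [g] and [f] are generalized. *)
Lemma Ck_ray_avg k g f : continuous g -> Ck k f -> Ck k (ray_avg g f).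
Proof.
elim: k g f => [|k IH] g f cg fk; first exact: continuous_ray_avg.
have f1 : Ck 1 f by elim: k {IH} fk => [//|k IHk] /CkS.
have csg : continuous (fun s : R => s * g s) by exact: (continuous_mulf (@continuous_idf R)).
split=> [p|i].
  apply: (@gateaux_differentiable R _ (fun p =>
    vec3 (ray_avg (fun s => s * g s) (partial ix f) p)
         (ray_avg (fun s => s * g s) (partial iy f) p) 0)).
    by move=> q v; exact: is_derive_ray_avg.
  apply: continuous_vec3; [| |exact: cst_continuous].
  - exact: continuous_ray_avg csg (@Ck_continuous _ _ 0 _ (Ck_partial ix f1)).
  - exact: continuous_ray_avg csg (@Ck_continuous _ _ 0 _ (Ck_partial iy f1)).
rewrite partial_ray_avg//; apply: IH; last exact: Ck_partial.
by apply: continuous_mulf => //; exact: cst_continuous.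
Qed.

End RadialPotential.

(** * Polar coordinates on the torus and passage from the interior to the closure *)

Section NeumannRadial.
Context {R : realType}.
Notation point := 'rV[R]_3.
Implicit Types (p : point) (r t z : R).

(** The angle is [acos (x / r)], with the sign of [y], because [r * sin (acos (x / r))] equals
    [|y|]. *)
Lemma exists_angle (x y : R) : exists t,
  x = Num.sqrt (x ^+ 2 + y ^+ 2) * cos t /\ y = Num.sqrt (x ^+ 2 + y ^+ 2) * sin t.
Proof.
set r := Num.sqrt _.
have r2 : r ^+ 2 = x ^+ 2 + y ^+ 2 by rewrite sqr_sqrtr// addr_ge0// sqr_ge0.
have r0 : 0 <= r by exact: sqrtr_ge0.
have [re|rn] := eqVneq r 0.
  exists 0; rewrite re !mul0r.
  move: r2; rewrite re expr0n/= => /esym/eqP.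
  by rewrite paddr_eq0 ?sqr_ge0// !sqrf_eq0 => /andP[/eqP-> /eqP->].
have rp : 0 < r by rewrite lt_def rn.
have xr : -1 <= x / r <= 1.
  have : `|x| <= r by rewrite -sqrtr_sqr ler_wsqrtr// lerDl sqr_ge0.
  by rewrite ler_norml ler_pdivlMr// ler_pdivrMr// mulN1r mul1r.
have xE : x = r * cos (acos (x / r)).
  by rewrite acosK ?in_itv//= mulrC divfK.
have sE : r * sin (acos (x / r)) = `|y|.
  rewrite sin_acos// -[X in X * _](ger0_norm r0) -sqrtr_sqr -sqrtrM ?sqr_ge0//.
  rewrite -(sqrtr_sqr y); congr Num.sqrt.
  by rewrite mulrBr mulr1 -exprMn mulrC divfK// r2 addrAC subrr add0r.
have [y0|y0] := leP 0 y.
  by exists (acos (x / r)); rewrite -xE sE ger0_norm.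
exists (- acos (x / r)); rewrite cosN sinN mulrN -xE sE ltr0_norm//.
by rewrite opprK.
Qed.

Lemma solid_torusP p : solid_torus p -> exists r t z, 0 <= r <= 1 /\ p = polar r t z.
Proof.
move=> Mp; have [t [ex ey]] := exists_angle (p 0 ix) (p 0 iy).
exists (cyl_radius p), t, (p 0 iz); split; first by rewrite sqrtr_ge0.
by rewrite /polar -ex -ey -vec3_eta.
Qed.

Lemma eq0_closed_unit_itv (f : R -> R) : continuous f ->
  (forall r, 0 < r < 1 -> f r = 0) -> forall r, 0 <= r <= 1 -> f r = 0.
Proof.
move=> cf f0 r /andP[r0 r1]; apply/eqP/negP => /negP fr.
have fr0 : 0 < `|f r| by rewrite normr_gt0.
have /cvgrPdist_lt /(_ _ fr0) [e /= e0 fe] := cf r.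
(* The point [r + d * (2^-1 - r)] is moved from [r] towards the midpoint of the interval: it lies in
   []0, 1[] and at distance at most [d / 2] from [r]. *)
pose d := Num.min e 2^-1.
have d0 : 0 < d by rewrite lt_min invr_gt0 ltr0n andbT; exact: e0.
have de : d <= e by rewrite ge_min lexx.
have d2 : d <= 2^-1 by rewrite ge_min lexx orbT.
have dr : `|r - (r + d * (2^-1 - r))| < e.
  rewrite opprD addrA subrr add0r normrN normrM gtr0_norm//.
  apply: (@le_lt_trans _ _ (d * 2^-1)).
    rewrite ler_pM2l// ler_norml; lra.
  lra.
have rd : 0 <= r * (1 - d) by rewrite mulr_ge0//; lra.
have rd' : 0 <= (1 - r) * (1 - d) by rewrite mulr_ge0//; lra.
have fx : f (r + d * (2^-1 - r)) = 0 by apply: f0; apply/andP; split; lra.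
by have := fe _ dr; rewrite /= fx subr0 ltxx.
Qed.

(** The axis and the boundary are limits along radii. This is how frame computations, valid for
    [0 < r < 1], become statements about the closed torus. *)
Lemma eq_on_solid_torus (A B : point -> R) : continuous A -> continuous B ->
  (forall r t z, 0 < r < 1 -> A (polar r t z) = B (polar r t z)) ->
  forall p, solid_torus p -> A p = B p.
Proof.
move=> cA cB AB p /solid_torusP[r [t [z [r01 ->]]]].
apply/eqP; rewrite -subr_eq0; apply/eqP; move: r r01.
apply: eq0_closed_unit_itv => [|r r01]; last by rewrite AB ?subrr.
move=> r; apply: cvgB.
  exact: (@continuous3_1 R _ t z (continuous3_polar cA)).
exact: (@continuous3_1 R _ t z (continuous3_polar cB)).
Qed.

(** At interior points an identity known only on the torus holds in a full neighbourhood and can be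
    differentiated. *)
Lemma solid_torus_near r t z : 0 <= r < 1 -> \forall q \near polar r t z, solid_torus q.
Proof.
move=> /andP[r0 r1].
have cr : continuous (fun p : point => cyl_radius p).
  apply: (@continuous_fcomp _ _ _ (fun p : point => p 0 ix ^+ 2 + p 0 iy ^+ 2)); last first.
    exact: sqrt_continuous.
  by apply: continuous_addf; apply: continuous_mulf; exact: continuous_coordrV.
have /cvgr_lt /(_ 1) := cr (polar r t z).
by rewrite cyl_radius_polar// => /(_ r1); apply: filterS => q /ltW.
Qed.

Lemma near_unit_itv r : 0 < r < 1 -> \forall s \near r, 0 < s < 1.
Proof.
move=> r01; have : r \in `]0, 1[ by rewrite in_itv.
by move=> /near_in_itvoo; apply: filterS => s; rewrite in_itv.
Qed.

Lemma grad_eq_polar (q : point -> R) (a r t z : R) : r != 0 -> differentiable q (polar r t z) ->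
  is_derive r 1 (fun r => q (polar r t z)) a ->
  is_derive t 1 (fun t => q (polar r t z)) 0 ->
  is_derive z 1 (fun z => q (polar r t z)) 0 ->
  grad q (polar r t z) = a *: e_r t.
Proof.
move=> r0 dq dr dt dz.
have [_ er] := @is_derive_along _ q (fun r => polar r t z) _ _ dq (is_derive_polar_r r t z).
have [_ et] := @is_derive_along _ q (fun t => polar r t z) _ _ dq (is_derive_polar_t r t z).
have [_ ez] := @is_derive_along _ q (fun z => polar r t z) _ _ dq (is_derive_polar_z r t z).
have {er dr} : dot (grad q (polar r t z)) (e_r t) = a by case: dr => _; exact: etrans (esym er).
have {et dt} : dot (grad q (polar r t z)) (r *: e_theta t) = 0.
  by case: dt => _; exact: etrans (esym et).
have {ez dz} : dot (grad q (polar r t z)) (vec3 0 0 1) = 0.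
  by case: dz => _; exact: etrans (esym ez).
move: (grad _ _) => g; rewrite linearZ /= !dotE /e_r /e_theta !(vec3E _ _ _) !mulr0 !addr0 add0r mulr1.
move=> g3 /eqP; rewrite mulf_eq0 (negbTE r0)/= => /eqP g2 g1.
have cs := cos2Dsin2 t; rewrite !expr2 in cs.
have h k : k * (cos t * cos t + sin t * sin t) = k by rewrite cs mulr1.
(* The radial and angular equations [g1] and [g2] are solved for the horizontal components by
   rotating back by the angle [t]. *)
apply: point_ext; rewrite !(vec3E, mxE)/= ?mulr0//.
- have := h (g 0 ix); have := congr1 ( *%R^~ (cos t)) g1.
  have := congr1 ( *%R^~ (sin t)) g2; rewrite /=; lra.
- have := h (g 0 iy); have := congr1 ( *%R^~ (sin t)) g1.
  have := congr1 ( *%R^~ (cos t)) g2; rewrite /=; lra.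
Qed.

End NeumannRadial.

(** * Explicit potential and Neumann solution for a radial field *)

Section RadialField.
Context {R : realType}.
Notation point := 'rV[R]_3.
Implicit Types (p : point) (r t z : R).

Lemma disk_proj_polar (s r t z : R) : s *: disk_proj (polar r t z) = polar (s * r) t 0.
Proof. by apply: point_ext; rewrite !(vec3E, mxE)/= ?mulr0 ?mulrA. Qed.

Lemma smooth_coord (V : point -> point) j : smooth V -> smooth (fun p => V p 0 j).
Proof. by move=> sV k; have /Ck_vecP := sV k; exact. Qed.

Lemma is_derive_const_eq (f : R -> R) (x : R) : (forall y, f y = f x) -> is_derive x 1 f 0.
Proof.
move=> fx; have -> : f = fun=> f x by apply/funext.
exact: is_derive_constf.
Qed.

(* The potential is q(p) = int_0^1 <F(s p'), p'> ds, where p' = (x, y, 0). *)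
Lemma radial_potential (F : point -> point) (psi : R -> R) : smooth F ->
  (forall p, solid_torus p -> F p = psi (cyl_radius p) *: outward_normal p) ->
  exists2 q : point -> R, smooth_on_torus q &
    forall p, solid_torus p -> grad q p = F p.
Proof.
move=> sF Fpsi.
pose one (s : R) : R := 1.
have c1 : continuous one by exact: cst_continuous.
pose A j := ray_avg one (fun p => F p 0 j).
have sA j : smooth (A j) by move=> k; apply: Ck_ray_avg => //; exact: smooth_coord.
pose q p := p 0 ix * A ix p + p 0 iy * A iy p.
have sq : smooth q by move=> k; apply: CkD; apply: CkM; (exact: Ck_coord || exact: sA).
exists q.
  split=> // p; rewrite /q /A /ray_avg !mxE/= !addr0.
  have -> // : disk_proj (p + vec3 0 0 (2 * pi)) = disk_proj p.
  by rewrite /disk_proj !mxE/= !addr0.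
have FP r t z : 0 <= r <= 1 -> F (polar r t z) = (psi r * r) *: e_r t.
  move=> r01; rewrite Fpsi; last exact: solid_torus_polar.
  by rewrite cyl_radius_polar ?outward_normal_polar ?scalerA//; case/andP: r01.
(* Rotational symmetry reduces both averages to this profile on the positive x-axis, so that [q]
   takes the value [r * B r] at radius [r]. *)
pose B r := A ix (polar r 0 0).
have AP j r t z : 0 <= r <= 1 -> A j (polar r t z) = e_r t 0 j * B r.
  move=> /andP[r0 r1]; rewrite /B /A /ray_avg.
  rewrite -segintZ; last first.
    apply: continuous_mulf => //.
    have cp : continuous (fun s : R => s *: disk_proj (polar r 0 0)).
      apply: (continuous_scale_disk (b := fun=> _)); last exact: cst_continuous.
      by move=> x; exact: cvg_id.
    exact: (continuous_fcomp cp (Ck_continuous (smooth_coord ix sF 0))).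
  apply: eq_segint => s /andP[s0 s1]; rewrite !disk_proj_polar.
  have sr : 0 <= s * r <= 1 by rewrite mulr_ge0// mulr_ile1.
  rewrite !FP// !mxE/= cos0 mulr1; ring.
have qP r t z : 0 <= r <= 1 -> q (polar r t z) = r * B r.
  move=> r01; rewrite /q !AP// /e_r /polar !vec3E.
  by rewrite -[RHS]mulr1 -(cos2Dsin2 t) !expr2; ring.
have dF j p : differentiable (fun p => F p 0 j) p.
  exact: (Ck_differentiable _ (smooth_coord j sF 1)).
have dQ r : is_derive r 1 (fun r => r * B r) (F (polar r 0 0) 0 ix).
  have dB : is_derive r 1 B (partial ix (A ix) (polar r 0 0)).
    have := @is_derive_along _ (A ix) (fun r => polar r 0 0) _ _
      (Ck_differentiable _ (sA ix 1)) (is_derive_polar_r r 0 0).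
    by congr is_derive; rewrite dotE /e_r sin0 cos0 !vec3E !mulr0 !addr0 mulr1 mxE.
  have := is_derive_mulf (is_derive_id r 1) dB; congr is_derive.
  rewrite mulr1 partial_ray_avg//; last exact: smooth_coord.
  (* The derivative of [r * B r] is the integral over [[0, 1]] of [h], the [s]-derivative of [H].
     The fundamental theorem in [s] thus gives [H 1 - H 0], the value of the field at radius [r],
     without dividing by [r]. *)
  pose H (s : R) := s * F (polar (s * r) 0 0) 0 ix.
  pose h (s : R) := s * (r * partial ix (fun p => F p 0 ix) (polar (s * r) 0 0)) +
    F (polar (s * r) 0 0) 0 ix.
  have cpol : continuous (fun s : R => polar (s * r) 0 0).
    apply: continuous_vec3; [| |exact: cst_continuous];
    by apply: continuous_mulf; [apply: continuous_mulf => [x|]; [exact: cvg_id|]|];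
      exact: cst_continuous.
  have cpF : continuous (partial ix (fun p => F p 0 ix)).
    exact: (Ck_continuous (Ck_partial ix (smooth_coord ix sF 1))).
  have c2 : continuous (fun s : R => F (polar (s * r) 0 0) 0 ix).
    exact: (continuous_fcomp cpol (Ck_continuous (smooth_coord ix sF 0))).
  have c3 : continuous (fun s : R => partial ix (fun p => F p 0 ix) (polar (s * r) 0 0)).
    exact: (continuous_fcomp cpol cpF).
  have c4 : continuous (fun s : R => s * partial ix (fun p => F p 0 ix) (polar (s * r) 0 0)).
    by apply: continuous_mulf c3 => x; exact: cvg_id.
  have ch : continuous h.
    apply: continuous_addf c2; apply: continuous_mulf => [x|]; first exact: cvg_id.
    by apply: continuous_mulf c3; exact: cst_continuous.
  have dH (s : R) : 0 <= s <= 1 -> is_derive s 1 H (h s).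
    move=> _; apply: is_derive_eq.
      apply: is_derive_mulf (is_derive_id s 1) _.
      apply: (@is_derive_along _ (fun p => F p 0 ix) (fun s => polar (s * r) 0 0)) => //.
      by apply: is_derive_vec3; exact: (is_derive_mulf
        (is_derive_mulf (is_derive_id s 1) (is_derive_constf r s)) (is_derive_constf _ s)).
    rewrite /h dotE !vec3E !mxE sin0 cos0 /GRing.scale/=.
    by move: (partial ix _ _) (partial iy _ _) (partial iz _ _) (F _ _ _) => *; ring.
  have <- : segint 0 1 h = F (polar r 0 0) 0 ix.
    by rewrite (segint_FTC ler01 dH ch) /H !mul0r subr0 !mul1r.
  have -> : ray_avg (fun s => (ix != iz)%:R * (s * one s)) (partial ix (fun p => F p 0 ix))
      (polar r 0 0) =
      segint 0 1 (fun s => s * partial ix (fun p => F p 0 ix) (polar (s * r) 0 0)).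
    by apply: eq_segint => s _; rewrite disk_proj_polar /one mul1r mulr1.
  have -> : B r = segint 0 1 (fun s => F (polar (s * r) 0 0) 0 ix).
    by apply: eq_segint => s _; rewrite disk_proj_polar mul1r.
  rewrite -(segintZ r _ _ c4) -segintD//.
    by apply: eq_segint => s _; rewrite /h; ring.
  by apply: continuous_mulf c4; exact: cst_continuous.
have gradP r t z : 0 < r < 1 -> grad q (polar r t z) = F (polar r t z).
  move=> r01; have /andP[r0 r1] := r01.
  have r01c : 0 <= r <= 1 by rewrite !ltW.
  rewrite FP//; apply: grad_eq_polar.
  - by rewrite gt_eqF.
  - exact: (Ck_differentiable _ (sq 1)).
  - have := dQ r; rewrite FP// !mxE/= cos0 mulr1.
    apply: near_eq_is_derive.
    by apply: filterS (near_unit_itv r01) => s /andP[s0 s1]; rewrite qP// !ltW.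
  - by apply: is_derive_const_eq => s; rewrite !qP.
  - by apply: is_derive_const_eq => s; rewrite !qP.
move=> p Mp; apply/rowP => j; move: p Mp.
apply: eq_on_solid_torus => [||r t z r01]; last by rewrite gradP.
- have sg : smooth (grad q) by move=> k; exact: Ck_grad.
  exact: (Ck_continuous (smooth_coord j sg 0)).
- exact: (Ck_continuous (smooth_coord j sF 0)).
Qed.

Lemma laplacian_divergence (q : point -> R) p : smooth q ->
  laplacian q p = divergence (grad q) p.
Proof.
move=> sq; rewrite /laplacian /divergence; apply: eq_bigr => i _.
have dg : differentiable (grad q) p by exact: (Ck_differentiable _ (Ck_grad (sq 2))).
rewrite [in RHS]/partial (derive_coord _ _ dg) /partial.
by have -> : (fun x => grad q x 0 i) = partial i q by apply/funext => x; rewrite mxE.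
Qed.

(** Equality of [grad q] and [F] on the torus gives equality of derivatives only at interior points;
    the two divergences then agree on the boundary by continuity. *)
Lemma neumann_of_potential (F : point -> point) (q : point -> R) :
  smooth F -> smooth_on_torus q -> (forall p, solid_torus p -> grad q p = F p) ->
  neumann_solution F q.
Proof.
move=> sF [sq pq] qF; split=> //; last first.
  by move=> p Bp; rewrite qF// /solid_torus/= Bp.
have sg : smooth (grad q) by move=> k; exact: Ck_grad.
have dF p : differentiable F p by exact: (Ck_differentiable _ (sF 1)).
have dg p : differentiable (grad q) p by exact: (Ck_differentiable _ (sg 1)).
have cdiv (V : point -> point) : smooth V -> continuous (divergence V).
  move=> sV.
  have -> : divergence V = fun p => partial ix (fun q : point => V q 0 ix) p +
      partial iy (fun q : point => V q 0 iy) p + partial iz (fun q : point => V q 0 iz) p.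
    by apply/funext => p; rewrite divergenceE//; exact: (Ck_differentiable _ (sV 1)).
  have cp j : continuous (partial j (fun q : point => V q 0 j)).
    exact: (Ck_continuous (Ck_partial j (smooth_coord j sV 1))).
  by apply: continuous_addf => //; apply: continuous_addf.
move=> p Mp; rewrite laplacian_divergence//; move: p Mp.
apply: eq_on_solid_torus; [exact: cdiv|exact: cdiv|] => r t z /andP[r0 r1].
rewrite /divergence; apply: eq_bigr => i _.
apply: (congr1 (fun M : point => M 0 i)); apply: near_eq_derive.
by apply: filterS (solid_torus_near t z _) => [x|]; [exact: qF|rewrite ltW].
Qed.

End RadialField.

(** * Orthogonality of gradients and solenoidal fields *)

Section TorusFields.
Context {R : realType}.
Notation point := 'rV[R]_3.
Implicit Types (p : point) (U V W : point -> point).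

Lemma L2innerDl U V W : continuous U -> continuous V -> continuous W ->
  L2inner (U \+ V) W = L2inner U W + L2inner V W.
Proof.
move=> cU cV cW; rewrite /L2inner -torus_integralD; try exact: continuous_dot.
by apply: eq_torus_integral => p _; rewrite dotDl.
Qed.

Lemma L2innerBl U V W : continuous U -> continuous V -> continuous W ->
  L2inner (U \- V) W = L2inner U W - L2inner V W.
Proof.
move=> cU cV cW; rewrite -[X in _ - X]mul1r -mulNr /L2inner.
rewrite -torus_integralZ; last exact: continuous_dot.
rewrite -torus_integralD; [|exact: continuous_dot|]; last first.
  by apply: continuous_mulf; [exact: cst_continuous|exact: continuous_dot].
by apply: eq_torus_integral => p _; rewrite dotBl mulN1r.
Qed.

(** For [A > 0] the pair [(B, - A)] minimizes the form at fixed second entry and yields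
    [0 <= A * (A * C - B ^+ 2)]. When [A = 0], the pairs [(C, - B)] and [(1, - B)] force [B = 0]. *)
Lemma quadratic_form_ge0 (A B C : R) :
  (forall x y, 0 <= x ^+ 2 * A + 2 * x * y * B + y ^+ 2 * C) -> B ^+ 2 <= A * C.
Proof.
move=> q; have A0 : 0 <= A by have := q 1 0; lra.
have C0 : 0 <= C by have := q 0 1; lra.
move: A0; rewrite le_eqVlt => /predU1P[A0|A0].
  move: C0; rewrite le_eqVlt => /predU1P[C0|C0].
    by have := q 1 (- B); rewrite -A0 -C0; nra.
  have := q C (- B); rewrite -A0 => h.
  have : 0 <= C * (- B ^+ 2) by lra.
  by rewrite pmulr_rge0//; lra.
have := q B (- A) => h.
have : 0 <= A * (A * C - B ^+ 2) by lra.
by rewrite pmulr_rge0//; lra.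
Qed.

(** Serves both for the sign of the denominator of the sectional curvature and to deduce
    orthogonality to everything from a zero norm. *)
Lemma L2inner_cauchy_schwarz V W : continuous V -> continuous W ->
  L2inner V W ^+ 2 <= L2inner V V * L2inner W W.
Proof.
move=> cV cW; apply: quadratic_form_ge0 => x y.
have cd U U' : continuous U -> continuous U' -> continuous (fun p => dot (U p) (U' p)).
  exact: continuous_dot.
have ck k (f : point -> R) : continuous f -> continuous (fun p => k * f p).
  by apply: continuous_mulf; exact: cst_continuous.
rewrite /L2inner -!torus_integralZ; try exact: cd.
rewrite -!torus_integralD; try (apply: ck; exact: cd).
  apply: torus_integral_ge0.
    by repeat apply: continuous_addf; apply: ck; exact: cd.
  move=> p _; rewrite !dotE.
  have -> : forall v1 v2 v3 w1 w2 w3 : R,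
    x ^+ 2 * (v1 * v1 + v2 * v2 + v3 * v3) + 2 * x * y * (v1 * w1 + v2 * w2 + v3 * w3) +
    y ^+ 2 * (w1 * w1 + w2 * w2 + w3 * w3) =
    (x * v1 + y * w1) ^+ 2 + (x * v2 + y * w2) ^+ 2 + (x * v3 + y * w3) ^+ 2.
    by move=> *; ring.
  by rewrite !addr_ge0// sqr_ge0.
by apply: continuous_addf; apply: ck; exact: cd.
Qed.

Lemma periodic_derive (W : normedModType R) (f : point -> W) v :
  z_periodic f -> z_periodic (fun p => 'D_v f p).
Proof.
move=> pf p; rewrite /derive; congr (lim _).
suff -> : (fun h : R => h^-1 *: ((f \o shift (p + vec3 0 0 (2 * pi))) (h *: v) -
    f (p + vec3 0 0 (2 * pi)))) = (fun h => h^-1 *: ((f \o shift p) (h *: v) - f p)) by [].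
by apply/funext => h /=; rewrite addrA !pf.
Qed.

Lemma smooth_on_torus_grad (q : point -> R) : smooth_on_torus q -> smooth_on_torus (grad q).
Proof.
move=> [sq pq]; split=> [k|p]; first exact: Ck_grad.
by apply/rowP => i; rewrite !mxE; exact: periodic_derive.
Qed.

Lemma smooth_on_torus_nabla U V :
  smooth_on_torus U -> smooth_on_torus V -> smooth_on_torus (nabla U V).
Proof.
move=> [sU pU] [sV pV]; split=> [k|p]; first exact: Ck_nabla.
by rewrite /nabla pU; exact: periodic_derive.
Qed.

Lemma smooth_on_torusB U V :
  smooth_on_torus U -> smooth_on_torus V -> smooth_on_torus (U \- V).
Proof.
move=> [sU pU] [sV pV]; split=> [k|p]; first exact: CkB_vec.
by rewrite /= pU pV.
Qed.

Lemma smooth_on_torusD U V :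
  smooth_on_torus U -> smooth_on_torus V -> smooth_on_torus (U \+ V).
Proof.
move=> [sU pU] [sV pV]; split=> [k|p]; first exact: CkD_vec.
by rewrite /= pU pV.
Qed.

Lemma smooth_on_torus_continuous (W : normedModType R) (f : point -> W) :
  smooth_on_torus f -> continuous f.
Proof. by move=> [/(_ 0) /Ck_continuous]. Qed.

(** The tangent space at the identity of the full group of volume-preserving diffeomorphisms, to
    which both [X] and [Y] belong. *)
Definition solenoidal V := [/\ smooth_on_torus V,
  forall p, solid_torus p -> divergence V p = 0 &
  forall p, torus_boundary p -> dot (V p) (outward_normal p) = 0].

Lemma L2inner_grad_solenoidal (q : point -> R) V :
  smooth_on_torus q -> solenoidal V -> L2inner (grad q) V = 0.
Proof.
by move=> [sq pq] [[sV pV] dV nV]; exact: torus_integral_grad_dot.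
Qed.

Lemma grad_dot U V p v : differentiable U p -> differentiable V p ->
  dot (grad (fun p => dot (U p) (V p)) p) v =
  dot ('D_v U p) (V p) + dot (U p) ('D_v V p).
Proof.
move=> dU dV; have dj W j : differentiable W p -> differentiable (fun q => W q 0 j) p.
  exact: differentiable_coordf.
have E : (fun p => dot (U p) (V p)) = fun p => U p 0 ix * V p 0 ix + U p 0 iy * V p 0 iy
  + U p 0 iz * V p 0 iz by apply/funext => q; rewrite dotE.
have dM j : derivable (fun q => U q 0 j * V q 0 j) p v.
  by apply: derivableM; apply: diff_derivable; exact: dj.
have dME j : 'D_v (fun q => U q 0 j * V q 0 j) p =
    U p 0 j * 'D_v (fun q => V q 0 j) p + V p 0 j * 'D_v (fun q => U q 0 j) p.
  by rewrite deriveM//; apply: diff_derivable; exact: dj.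
rewrite -derive_dot_grad; last first.
  rewrite E; repeat apply: differentiableD; by apply: differentiableM; exact: dj.
rewrite E deriveD//; last exact: derivableD.
rewrite deriveD// !dME.
move: (derive_coord v ix dU) (derive_coord v iy dU) (derive_coord v iz dU)
  (derive_coord v ix dV) (derive_coord v iy dV) (derive_coord v iz dV).
move: ('D_v U p) ('D_v V p) => DU DV <- <- <- <- <- <-.
by rewrite !dotE; ring.
Qed.

(** By compatibility with the metric, the two integrands add up to the derivative of [dot U W] along
    [V], and a gradient is orthogonal to the solenoidal field [V]. *)
Lemma nabla_by_parts U V W : solenoidal V -> smooth_on_torus U -> smooth_on_torus W ->
  L2inner (nabla V U) W = - L2inner U (nabla V W).
Proof.
move=> sV sU sW.
have cc (A : point -> point) : smooth_on_torus A -> continuous A by exact: smooth_on_torus_continuous.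
have sV' : smooth_on_torus V by case: sV.
apply/eqP; rewrite -subr_eq0 opprK; apply/eqP.
have dS : smooth_on_torus (fun p => dot (U p) (W p)).
  split=> [k|p]; first by apply: Ck_dot; [exact: sU.1|exact: sW.1].
  by rewrite sU.2 sW.2.
rewrite -(L2inner_grad_solenoidal dS sV) /L2inner -torus_integralD.
- apply: eq_torus_integral => p _; rewrite grad_dot//.
    exact: (Ck_differentiable _ (sU.1 1)).
  exact: (Ck_differentiable _ (sW.1 1)).
- by apply: continuous_dot; apply: cc => //; exact: smooth_on_torus_nabla.
- by apply: continuous_dot; apply: cc => //; exact: smooth_on_torus_nabla.
Qed.

Lemma divergenceB U V p : differentiable U p -> differentiable V p ->
  divergence (U \- V) p = divergence U p - divergence V p.
Proof.
move=> dU dV; rewrite /divergence -sumrB; apply: eq_bigr => i _.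
by rewrite /partial deriveB ?mxE//; exact: diff_derivable.
Qed.

Definition pressure V : point -> R := xget (fun=> 0) (neumann_solution V).

Lemma solenoidal_neumann V (q : point -> R) : smooth_on_torus V ->
  neumann_solution V q -> solenoidal (V \- grad q).
Proof.
move=> sV [sq lq nq]; have sg := smooth_on_torus_grad sq.
split=> [|p Mp|p Bp]; first exact: smooth_on_torusB.
- rewrite divergenceB; [|exact: (Ck_differentiable _ (sV.1 1))|
    exact: (Ck_differentiable _ (sg.1 1))].
  by rewrite -laplacian_divergence ?lq ?subrr//; exact: sq.1.
- by rewrite /= dotBl nq// subrr.
Qed.

(* When the Neumann problem for V has no solution, the pressure is the junk value 0. *)
Lemma pressureP V : neumann_solution V (pressure V) \/ pressure V = fun=> 0.
Proof.
have [[q qV]|nq] := pselect (exists q, neumann_solution V q).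
  by left; rewrite /pressure; case: xgetP => [//|/(_ q)].
by right; rewrite /pressure; case: xgetP => // q _ qV; case: nq; exists q.
Qed.

Lemma smooth_on_torus_pressure V : smooth_on_torus (pressure V).
Proof.
case: (pressureP V) => [[]//|->]; split=> // k; exact: Ck_cst.
Qed.

(** True in both cases of [pressureP]: a Neumann solution makes the projection solenoidal, hence
    orthogonal to gradients, and the default value has zero gradient. *)
Lemma L2inner_pressure V : smooth_on_torus V ->
  L2inner (grad (pressure V)) (div_free_proj V) = 0.
Proof.
move=> sV; case: (pressureP V) => [nV|->].
  apply: L2inner_grad_solenoidal; first exact: smooth_on_torus_pressure.
  exact: solenoidal_neumann.
rewrite /L2inner (_ : torus_integral _ = torus_integral (fun=> 0 * 0)).
  by rewrite torus_integralZ ?mul0r//; exact: cst_continuous.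
apply: eq_torus_integral => p _; have -> : grad (fun=> 0) p = 0 :> point.
  by apply/rowP => i; rewrite !mxE; exact: derive_cst.
by rewrite dotC linear0 mul0r.
Qed.

Lemma smooth_on_torus_proj V : smooth_on_torus V -> smooth_on_torus (div_free_proj V).
Proof.
move=> sV; apply: smooth_on_torusB => //; apply: smooth_on_torus_grad.
exact: smooth_on_torus_pressure.
Qed.

(** The two fields differ by the gradient of a smooth periodic function, whichever case of
    [pressureP] holds. *)
Lemma L2inner_proj V W : smooth_on_torus V -> solenoidal W ->
  L2inner (div_free_proj V) W = L2inner V W.
Proof.
move=> sV sW; have cW : continuous W by case: sW => /smooth_on_torus_continuous.
have sp := smooth_on_torus_pressure V.
rewrite L2innerBl//.
- by rewrite (L2inner_grad_solenoidal sp sW) subr0.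
- exact: smooth_on_torus_continuous.
- exact: (smooth_on_torus_continuous (smooth_on_torus_grad sp)).
Qed.

(* The projection of a gradient field is both a gradient and orthogonal to gradients. *)
Lemma L2inner_proj_potential V (q : point -> R) W : smooth_on_torus V -> smooth_on_torus W ->
  smooth_on_torus q -> (forall p, solid_torus p -> grad q p = V p) ->
  L2inner (div_free_proj V) W = 0.
Proof.
move=> sV sW sq qV.
have nq := neumann_of_potential sV.1 sq qV.
have nV : neumann_solution V (pressure V).
  by rewrite /pressure; case: xgetP => [//|/(_ q)].
have sG := solenoidal_neumann sV nV.
have GG : L2inner (div_free_proj V) (div_free_proj V) = 0.
  rewrite -[RHS](L2inner_grad_solenoidal sq sG) [in LHS]L2innerBl.
  - rewrite (L2inner_grad_solenoidal (smooth_on_torus_pressure V) sG) subr0.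
    by apply: eq_torus_integral => p Mp; rewrite qV.
  - exact: smooth_on_torus_continuous.
  - by apply: smooth_on_torus_continuous; apply: smooth_on_torus_grad; case: nV.
  - by apply: smooth_on_torus_continuous; exact: smooth_on_torus_proj.
(* A projection of zero norm is orthogonal to every smooth [W], solenoidal or not. *)
have := @L2inner_cauchy_schwarz (div_free_proj V) W
  (smooth_on_torus_continuous (smooth_on_torus_proj sV)) (smooth_on_torus_continuous sW).
by rewrite GG mul0r -subr_ge0 sub0r oppr_ge0 => h; apply/eqP; rewrite -sqrf_eq0 eq_le h sqr_ge0.
Qed.

End TorusFields.

(** * Rotational fields and their curvature *)

Section Frame.
Context {R : realType}.
Notation point := 'rV[R]_3.
Implicit Types (p v : point) (V : point -> point).

Definition frame (t a b c : R) : point :=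
  vec3 (a * cos t - b * sin t) (a * sin t + b * cos t) c.

Let sq_cos (t : R) : cos t * cos t + sin t * sin t = 1.
Proof. by have := cos2Dsin2 t; rewrite !expr2. Qed.

Lemma frame_eta t v : v = frame t (dot v (e_r t)) (dot v (e_theta t)) (v 0 iz).
Proof.
apply: point_ext; rewrite /frame !dotE /e_r /e_theta !vec3E //.
  by rewrite -[LHS]mulr1 -(sq_cos t); ring.
by rewrite -[LHS]mulr1 -(sq_cos t); ring.
Qed.

Lemma dot_frame t a b c a' b' c' :
  dot (frame t a b c) (frame t a' b' c') = a * a' + b * b' + c * c'.
Proof.
rewrite dotE /frame !vec3E; congr (_ + _).
by rewrite -[RHS]mulr1 -(sq_cos t); ring.
Qed.

Lemma frameB t a b c a' b' c' :
  frame t a b c - frame t a' b' c' = frame t (a - a') (b - b') (c - c').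
Proof. by apply: point_ext; rewrite !(mxE, vec3E)/=; ring. Qed.

Lemma e_rE t : e_r t = frame t 1 0 0.
Proof. by apply: point_ext; rewrite /frame /e_r !vec3E; ring. Qed.

Lemma e_thetaE t : e_theta t = frame t 0 1 0.
Proof. by apply: point_ext; rewrite /frame /e_theta !vec3E; ring. Qed.

Lemma jacob_frame V p t a b c : jacob V p (frame t a b c) =
  a *: jacob V p (e_r t) + b *: jacob V p (e_theta t) + c *: jacob V p (vec3 0 0 1).
Proof.
by apply: point_ext; rewrite !(mxE, vec3E)/= !dotE /frame /e_r /e_theta !vec3E; ring.
Qed.

End Frame.

(** * The rotational field in the moving frame: Jacobian, divergence, self-derivative *)

Section RotationalField.
Context {R : realType} (u : R -> R) (X : 'rV[R]_3 -> 'rV[R]_3).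
Context (sX : smooth_on_torus X)
  (XE : forall p, solid_torus p -> X p = u (cyl_radius p) *: rotE p).
Notation point := 'rV[R]_3.
Implicit Types (p v : point) (r t z : R).

Let dX p : differentiable X p.
Proof. exact: (Ck_differentiable _ (sX.1 1)). Qed.

Lemma X_polar r t z : 0 <= r <= 1 -> X (polar r t z) = (u r * r) *: e_theta t.
Proof.
move=> r01; have /andP[r0 r1] := r01.
rewrite XE; last exact: solid_torus_polar.
by rewrite cyl_radius_polar// rotE_polar scalerA.
Qed.

(* Equals r u(r) for 0 <= r <= 1; unlike u, it is smooth on the whole line. *)
Definition speed r : R := X (polar r 0 0) 0 iy.
Definition dspeed r : R := partial ix (fun p => X p 0 iy) (polar r 0 0).

Lemma speedE r : 0 <= r <= 1 -> speed r = u r * r.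
Proof. by move=> r01; rewrite /speed X_polar// !mxE/= cos0 mulr1. Qed.

Lemma is_derive_speed r : is_derive r 1 speed (dspeed r).
Proof.
have := @is_derive_along _ (fun p => X p 0 iy) (fun r => polar r 0 0) r _
  (differentiable_coordf iy (dX _)) (is_derive_polar_r r 0 0).
by congr is_derive; rewrite dotE /e_r sin0 cos0 !vec3E !mulr0 !addr0 mulr1 mxE.
Qed.

(** Gives the columns of the Jacobian of [X]: along a coordinate curve, [X] coincides near the point
    with an explicit curve, and derivatives are unique. *)
Lemma is_derive_vec_near (A B : R -> point) (x : R) a b :
  (\forall y \near x, A y = B y) -> is_derive x 1 A a -> is_derive x 1 B b -> a = b.
Proof. by move=> AB [_ <-] [_ <-]; exact: near_eq_derive. Qed.

Lemma is_derive_scale_vec (f : R -> R) (x d : R) v :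
  is_derive x 1 f d -> is_derive x 1 (fun y => f y *: v) (d *: v).
Proof.
move=> df.
have -> : (fun y => f y *: v) = fun y => vec3 (f y * v 0 ix) (f y * v 0 iy) (f y * v 0 iz).
  by apply/funext => y; apply: point_ext; rewrite !(mxE, vec3E).
have -> : d *: v = vec3 (f x * 0 + v 0 ix * d) (f x * 0 + v 0 iy * d) (f x * 0 + v 0 iz * d).
  by apply: point_ext; rewrite !(mxE, vec3E)/= mulr0 add0r mulrC.
by apply: is_derive_vec3; apply: is_derive_mulf; exact: is_derive_constf.
Qed.

Lemma jacob_X_r r t z : 0 < r < 1 -> jacob X (polar r t z) (e_r t) = dspeed r *: e_theta t.
Proof.
move=> r01; apply: (is_derive_vec_near _ (is_derive_along_vec (dX _) (is_derive_polar_r r t z))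
  (is_derive_scale_vec (e_theta t) (is_derive_speed r))).
apply: filterS (near_unit_itv r01) => s /andP[s0 s1].
by rewrite X_polar ?speedE ?ltW.
Qed.

(** Circles of constant [r] and [z] stay in the torus, so [r = 0] and [r = 1] are allowed, unlike
    for the radial derivative. *)
Lemma jacob_X_t r t z : 0 <= r <= 1 ->
  jacob X (polar r t z) (r *: e_theta t) = - (u r * r) *: e_r t.
Proof.
move=> r01.
have d1 : is_derive t 1 (fun t => (u r * r) *: e_theta t) ((u r * r) *: - e_r t).
  exact: is_deriveZ (is_derive_e_theta t).
rewrite scaleNr -scalerN.
apply: (is_derive_vec_near _ (is_derive_along_vec (dX _) (is_derive_polar_t r t z)) d1).
by near=> s; rewrite X_polar.
Unshelve. all: by end_near. Qed.

Lemma jacob_X_theta r t z : 0 < r <= 1 ->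
  jacob X (polar r t z) (e_theta t) = - u r *: e_r t.
Proof.
move=> /andP[r0 r1].
have := @jacob_X_t r t z; rewrite (ltW r0) r1 jacobZ => /(_ isT).
move/(congr1 ( *:%R r^-1)); rewrite !scalerA mulVf ?gt_eqF// scale1r => ->.
by congr (_ *: _); rewrite mulrN mulrCA mulVf ?gt_eqF// mulr1.
Qed.

Lemma jacob_X_z r t z : 0 <= r <= 1 -> jacob X (polar r t z) (vec3 0 0 1) = 0.
Proof.
move=> r01.
apply: (is_derive_vec_near _ (is_derive_along_vec (dX _) (is_derive_polar_z r t z))
  (is_derive_cst ((u r * r) *: e_theta t) z 1)).
by near=> s; rewrite X_polar.
Unshelve. all: by end_near. Qed.

Lemma jacob_X_frame r t z a b c : 0 < r < 1 ->
  jacob X (polar r t z) (frame t a b c) = frame t (- u r * b) (dspeed r * a) 0.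
Proof.
move=> r01; have /andP[r0 r1] := r01.
rewrite jacob_frame jacob_X_r// jacob_X_theta ?r0 ?ltW// jacob_X_z ?ltW//.
by apply: point_ext; rewrite /frame /e_r /e_theta !(mxE, vec3E)/=; ring.
Qed.

Lemma solenoidal_X : solenoidal X.
Proof.
split=> // [|p Bp].
  apply: eq_on_solid_torus; [|exact: cst_continuous|].
    have cp j : continuous (fun p => partial j X p 0 j).
      exact: (Ck_continuous (smooth_coord j (fun k => Ck_partial j (sX.1 k.+1)) 0)).
    have -> : divergence X = fun p => partial ix X p 0 ix + partial iy X p 0 iy +
      partial iz X p 0 iz by apply/funext => p; rewrite /divergence sum_ord3.
    by apply: continuous_addf => //; apply: continuous_addf.
  (* In the frame the Jacobian of [X] has zero diagonal: it sends [e_r] to a multiple of [e_theta],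
     [e_theta] to a multiple of [e_r], and the vertical vector to 0. *)
  move=> r t z r01; have /andP[r0 r1] := r01.
  rewrite (divergence_frame t)// jacob_X_r// jacob_X_theta ?r0 ?ltW// jacob_X_z ?ltW//.
  rewrite !dotZl e_rE e_thetaE !dot_frame mxE; ring.
rewrite XE; last by rewrite /solid_torus/= Bp.
by rewrite dotZl dotE /rotE /outward_normal !vec3E; ring.
Qed.

Lemma nabla_X_X p : solid_torus p ->
  nabla X X p = (- u (cyl_radius p) ^+ 2) *: outward_normal p.
Proof.
move=> /solid_torusP[r [t [z [r01 ->]]]]; have /andP[r0 r1] := r01.
rewrite /nabla jacobE// cyl_radius_polar// outward_normal_polar X_polar//.
rewrite -scalerA jacobZ jacob_X_t// !scalerA; congr (_ *: _); ring.
Qed.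

(** Near [r] the function is [w^2 / r] with [w] the differentiable [speed], so no derivative of [u]
    has to be formed. *)
Lemma derive1_speed r : 0 < r < 1 ->
  derive1 (fun s : R => s * u s ^+ 2) r = 2 * u r * dspeed r - u r ^+ 2.
Proof.
move=> r01; have /andP[r0 r1] := r01; have rn0 : r != 0 by rewrite gt_eqF.
have dw := is_derive_speed r.
have dinv : is_derive r 1 (fun s : R => s^-1) (- r ^- 2).
  split; first exact: (@derivableV _ _ id).
  by rewrite (@deriveV _ _ id)// derive_id [LHS]mulr1.
have d1 := is_derive_mulf (is_derive_mulf dw dw) dinv.
rewrite derive1E.
have -> : 'D_1 (fun s : R => s * u s ^+ 2) r = 'D_1 (fun s => speed s * speed s * s^-1) r.
  apply: near_eq_derive; apply: filterS (near_unit_itv r01) => s /andP[s0 s1].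
  by rewrite speedE ?ltW//; field; rewrite gt_eqF.
case: d1 => _ ->; rewrite speedE ?ltW//; field.
by rewrite gt_eqF.
Qed.

End RotationalField.

(** * Assembling three L2 products into one integral *)

Section DotCombination.
Context {R : realType} (A A' B B' C C' : 'rV[R]_3 -> 'rV[R]_3).
Context (cA : continuous A) (cA' : continuous A') (cB : continuous B)
  (cB' : continuous B') (cC : continuous C) (cC' : continuous C').

Let cN1C : continuous (fun p => -1 * dot (C p) (C' p)).
Proof. by apply: continuous_mulf; [exact: cst_continuous|exact: continuous_dot]. Qed.

Lemma continuous_dot_combination : continuous
  (fun p => dot (A p) (A' p) + dot (B p) (B' p) + -1 * dot (C p) (C' p)).
Proof.
exact: (continuous_addf (continuous_addf (continuous_dot cA cA') (continuous_dot cB cB')) cN1C).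
Qed.

Lemma L2inner_combination :
  L2inner A A' + L2inner B B' - L2inner C C' = torus_integral
    (fun p => dot (A p) (A' p) + dot (B p) (B' p) + -1 * dot (C p) (C' p)).
Proof.
have c1 := continuous_dot cA cA'; have c2 := continuous_dot cB cB'.
rewrite (torus_integralD (continuous_addf c1 c2) cN1C) (torus_integralD c1 c2).
by rewrite (torus_integralZ _ (continuous_dot cC cC')) mulN1r.
Qed.

End DotCombination.

(** * Numerator of the curvature and sign of its integrand *)

Section CurvatureEstimate.
Context {R : realType} (u : R -> R) (X Y : 'rV[R]_3 -> 'rV[R]_3).
Context (sX : smooth_on_torus X)
  (XE : forall p, solid_torus p -> X p = u (cyl_radius p) *: rotE p)
  (tY : tangent_DmuE Y).
Notation point := 'rV[R]_3.
Implicit Types (p v : point) (r t z : R).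

Lemma solenoidal_Y : solenoidal Y.
Proof. by case: tY. Qed.

Let sY : smooth_on_torus Y.
Proof. by case: tY. Qed.

Let dY p : differentiable Y p.
Proof. exact: (Ck_differentiable _ (sY.1 1)). Qed.

Lemma derive_rotE p v : 'D_v rotE p = rotE v.
Proof.
have dc j : differentiable (fun q : point => q 0 j) p by exact: differentiable_coord.
have Dc j : 'D_v (fun q : point => q 0 j) p = v 0 j.
  by rewrite -(@derive_coord _ id) ?derive_id//; exact: ex_diff.
have cx : (fun q : point => rotE q 0 ix) = fun q => - q 0 iy.
  by apply/funext => q; rewrite vec3E.
have cy : (fun q : point => rotE q 0 iy) = fun q => q 0 ix.
  by apply/funext => q; rewrite vec3E.
have cz : (fun q : point => rotE q 0 iz) = fun q => 0.
  by apply/funext => q; rewrite vec3E.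
have dE : differentiable (rotE : point -> point) p.
  apply: differentiable_vec => j; case: (ord3P j) => ->; rewrite ?cx ?cy ?cz//.
  exact: differentiableN.
apply: point_ext; rewrite derive_coord// ?cx ?cy ?cz /rotE vec3E.
- by rewrite deriveN ?Dc//; exact: diff_derivable.
- exact: Dc.
- exact: derive_cst.
Qed.

(** The rotation field is linear, so its derivative along [Y] is [rotE (Y p)]; commuting with it
    makes the angular derivative of [Y] algebraic. *)
Lemma nabla_rotE_Y p : solid_torus p -> nabla rotE Y p = rotE (Y p).
Proof.
case: tY => _ _ _ EY Mp; have := EY p Mp.
by rewrite /lie_bracket /= => /subr0_eq ->; rewrite /nabla derive_rotE.
Qed.

Lemma nabla_X_Y r t z : 0 <= r <= 1 ->
  nabla X Y (polar r t z) = u r *: rotE (Y (polar r t z)).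
Proof.
move=> r01; have Mp := solid_torus_polar t z r01; have /andP[r0 _] := r01.
rewrite -nabla_rotE_Y// /nabla XE// cyl_radius_polar//.
by rewrite !jacobE// jacobZ.
Qed.

Lemma rotE_frame t (a b c : R) : rotE (frame t a b c) = frame t (- b) a 0.
Proof. by apply: point_ext; rewrite /rotE /frame !vec3E; ring. Qed.

Lemma is_derive_e_r t : is_derive t 1 e_r (e_theta t).
Proof. exact: is_derive_vec3. Qed.

(** Along a circle the derivative of this component vanishes: [rotE (Y p)] contributes minus the
    angular component of [Y], and the derivative of [e_r] contributes the same with a plus sign. *)
Lemma radial_component_Y r t z : 0 <= r <= 1 ->
  dot (Y (polar r t z)) (e_r t) = Y (polar r 0 z) 0 ix.
Proof.
move=> r01; pose f t := dot (Y (polar r t z)) (e_r t).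
have df (s : R) : is_derive s 1 f 0.
  have := is_derive_dot (is_derive_along_vec (dY _) (is_derive_polar_t r s z)) (is_derive_e_r s).
  congr is_derive.
  have -> : jacob Y (polar r s z) (r *: e_theta s) = rotE (Y (polar r s z)).
    by rewrite -nabla_rotE_Y /nabla ?rotE_polar ?jacobE//; exact: solid_torus_polar.
  by rewrite [Y _](frame_eta s) rotE_frame e_rE e_thetaE !dot_frame; ring.
rewrite -/(f t) (is_derive_0_is_cst t 0 df) /f /e_r cos0 sin0 dotE !vec3E.
by rewrite !mulr0 !addr0 mulr1.
Qed.

(** On each circle, [r] times the angular component of [grad q] is the derivative of a periodic
    function, and the weight [c] is constant there. At [r = 0], where one cannot divide by [r], the
    weight vanishes. *)
Lemma cylint_angular (c : R -> R -> R) (q : point -> R) :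
  continuous (fun x : R * R => c x.1 x.2) -> (forall z, c 0 z = 0) -> Ck 1 q ->
  cylint (fun r t z => c r z * dot (grad q (polar r t z)) (e_theta t)) = 0.
Proof.
move=> cc c0 q1; have cg : continuous (grad q) by exact: (Ck_continuous (Ck_grad q1)).
have cgt : continuous3 (fun r t z => dot (grad q (polar r t z)) (e_theta t)).
  by apply: continuous3_dot_polar cg _; exact: continuous3_e_theta.
have cc3 : continuous3 (fun r _ z => c r z).
  apply: (continuous_fcomp (continuous_pairf _ _) cc).
    exact: continuous3_r.
  by move=> x; exact: cvg_snd.
apply: cylint_eq0_t => [|r z _]; first exact: continuous3M.
have cgs := @continuous3_2 _ _ r z cgt.
rewrite segintZ//.
have [->|r0] := eqVneq r 0; first by rewrite c0 mul0r.
suff -> : segint 0 (2 * pi) (fun t => dot (grad q (polar r t z)) (e_theta t)) = 0.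
  by rewrite mulr0.
apply/eqP; rewrite -(mulrI_eq0 _ (mulfI r0)) -segintZ//; apply/eqP.
have dq t : 0 <= t <= 2 * pi -> is_derive t 1 (fun t => q (polar r t z))
    (r * dot (grad q (polar r t z)) (e_theta t)).
  move=> _; have := @is_derive_along _ q (fun t => polar r t z) t _
    (Ck_differentiable _ q1) (is_derive_polar_t r t z).
  by congr is_derive; rewrite linearZ.
rewrite (segint_FTC _ dq).
- by rewrite polar_2pi subrr.
- by rewrite mulr_ge0// pi_ge0.
- by apply: continuous_mulf => //; exact: cst_continuous.
Qed.

Let q1 := pressure (nabla Y X).
Let g := grad q1.
Let H := div_free_proj (nabla Y X).
Let N := nabla (lie_bracket X Y) X.

Let sYX : smooth_on_torus (nabla Y X).
Proof. exact: smooth_on_torus_nabla. Qed.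

Let sH : smooth_on_torus H.
Proof. exact: smooth_on_torus_proj. Qed.

Let sg : smooth_on_torus g.
Proof. by apply: smooth_on_torus_grad; exact: smooth_on_torus_pressure. Qed.

Let sXY : smooth_on_torus (nabla X Y).
Proof. exact: smooth_on_torus_nabla. Qed.

Let sN : smooth_on_torus N.
Proof. exact: (smooth_on_torus_nabla (smooth_on_torusB sXY sYX) sX). Qed.

(* The last term vanishes; it serves to complete the squares in the integrand. *)
Lemma curvature_numerator : L2inner (curvature Y X) Y =
  L2inner H (nabla X Y) + L2inner N Y - L2inner g H.
Proof.
have cf (V : point -> point) : smooth_on_torus V -> continuous V.
  exact: smooth_on_torus_continuous.
have sXX : smooth_on_torus (nabla X X) by exact: smooth_on_torus_nabla.
have sPXX : smooth_on_torus (div_free_proj (nabla X X)) by exact: smooth_on_torus_proj.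
have s1 : smooth_on_torus (nabla Y (div_free_proj (nabla X X))).
  exact: smooth_on_torus_nabla.
have s2 : smooth_on_torus (nabla X H) by exact: smooth_on_torus_nabla.
have s12 := smooth_on_torusB s1 s2.
have s3 : smooth_on_torus
    ((nabla Y (div_free_proj (nabla X X)) \- nabla X H) \+ N) by exact: smooth_on_torusD.
have sYY : smooth_on_torus (nabla Y Y) by exact: smooth_on_torus_nabla.
have [q0 sq0 q0E] :=
  @radial_potential _ _ (fun s => - u s ^+ 2) sXX.1 (nabla_X_X sX XE).
have e0 := L2inner_proj s3 solenoidal_Y.
have e1 := L2innerDl (cf _ s12) (cf _ sN) (cf _ sY).
have e2 := L2innerBl (cf _ s1) (cf _ s2) (cf _ sY).
(* Parts along [Y] pair the projection with [nabla Y Y], which need not be solenoidal; the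
   projection of the gradient field [nabla X X] is orthogonal to it all the same. *)
have e3 := etrans (nabla_by_parts solenoidal_Y sPXX sY)
  (congr1 -%R (L2inner_proj_potential sXX sYY sq0 q0E)).
have e4 := nabla_by_parts (solenoidal_X sX XE) sH sY.
have e5 : L2inner g H = 0 := L2inner_pressure sYX.
have arith (a b c d e : R) : a = - 0 -> b = - d -> e = 0 -> (a - b) + c = d + c - e.
  by move=> -> -> ->; rewrite oppr0 sub0r opprK addr0.
apply: etrans e0 _; apply: etrans e1 _.
apply: etrans (congr1 (fun x => x + L2inner N Y) e2) _.
exact: arith e3 e4 e5.
Qed.

(* The term with [speed] and [dspeed] integrates to zero over each circle by
   [cylint_angular].  In the frame (e_r, e_theta, e_z), writing a, b for the horizontal
   components of Y and w for the speed, the sum of all terms is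
   r ((2 u w' - u^2) a^2 + (u b + g_r)^2 + g_theta^2 + g_z^2). *)
Lemma curvature_integrand_ge0 r t z : 0 < r < 1 ->
  0 <= derive1 (fun s : R => s * u s ^+ 2) r ->
  0 <= (dot (H (polar r t z)) (nabla X Y (polar r t z)) +
        dot (N (polar r t z)) (Y (polar r t z)) -
        dot (g (polar r t z)) (H (polar r t z))) * r +
       (speed X r + r * dspeed X r) * Y (polar r 0 z) 0 ix *
       dot (g (polar r t z)) (e_theta t).
Proof.
move=> r01; have /andP[r0 r1] := r01.
have r01c : 0 <= r <= 1 by rewrite !ltW.
rewrite (derive1_speed sX XE)// => ru.
rewrite -(radial_component_Y t z r01c).
have dX : differentiable X (polar r t z) by exact: (Ck_differentiable _ (sX.1 1)).
have -> : H (polar r t z) = nabla Y X (polar r t z) - g (polar r t z) by [].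
(* In the frame, [[X, Y]] is purely angular with component [(u - w') a], so [N] is purely radial
   with component [- u (u - w') a]. *)
have -> : N (polar r t z) = jacob X (polar r t z)
    (nabla X Y (polar r t z) - nabla Y X (polar r t z)) by rewrite -jacobE.
have -> : nabla Y X (polar r t z) = jacob X (polar r t z) (Y (polar r t z)) by rewrite -jacobE.
rewrite nabla_X_Y//.
rewrite [Y (polar r t z)](frame_eta t) [g _](frame_eta t).
set a := dot (Y _) _; set b := dot (Y _) _; set y3 := Y _ 0 iz.
set gr := dot (g _) _; set gt := dot (g _) _; set g3 := g _ 0 iz.
rewrite rotE_frame (jacob_X_frame sX XE)//.
have uf (a' b' c' : R) : u r *: frame t a' b' c' = frame t (u r * a') (u r * b') (u r * c').
  by apply: point_ext; rewrite /frame !(mxE, vec3E)/=; ring.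
rewrite uf !frameB (jacob_X_frame sX XE)// e_rE e_thetaE !dot_frame (speedE XE)//.
set w := dspeed X r in ru *.
have nonneg (x : R) : x = r * ((2 * u r * w - u r ^+ 2) * a ^+ 2 +
  (u r * b + gr) ^+ 2 + gt ^+ 2 + g3 ^+ 2) -> 0 <= x.
  move=> ->; rewrite mulr_ge0 ?(ltW r0)// !addr_ge0 ?sqr_ge0//.
  by rewrite mulr_ge0 ?sqr_ge0.
apply: nonneg; ring.
Qed.

End CurvatureEstimate.

Unset Implicit Arguments.
Set Strict Implicit.

Theorem mainTheorem3 (R : realType) (u : R -> R) (X : 'rV[R]_3 -> 'rV[R]_3)
    (X_smooth : smooth_on_torus X)
    (X_def : forall p, solid_torus p -> X p = u (cyl_radius p) *: rotE p)
    (X_neq0 : exists2 p, solid_torus p & X p != 0)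
    (u_cond : forall r : R, 0 < r < 1 -> 0 <= derive1 (fun s : R => s * u s ^+ 2) r)
    (Y : 'rV[R]_3 -> 'rV[R]_3)
    (Y_tangent : tangent_DmuE Y)
    (XY_indep : lin_indep_on_torus X Y) :
  0 <= sectional_curvature X Y.
Proof.
have sY : smooth_on_torus Y by case: Y_tangent.
have cf (V : 'rV[R]_3 -> 'rV[R]_3) : smooth_on_torus V -> continuous V.
  exact: smooth_on_torus_continuous.
rewrite /sectional_curvature divr_ge0//; last first.
  by rewrite subr_ge0; apply: L2inner_cauchy_schwarz; exact: cf.
rewrite (curvature_numerator X_smooth X_def Y_tangent).
set H := div_free_proj _; set N := nabla _ X; set g := grad _.
have sYX : smooth_on_torus (nabla Y X) by exact: smooth_on_torus_nabla.
have cH : continuous H by apply: cf; exact: smooth_on_torus_proj.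
have cg : continuous g.
  by apply: cf; apply: smooth_on_torus_grad; exact: smooth_on_torus_pressure.
have sXY : smooth_on_torus (nabla X Y) by exact: smooth_on_torus_nabla.
have cXY := cf _ sXY.
have cN : continuous N.
  exact: (cf _ (smooth_on_torus_nabla (smooth_on_torusB sXY sYX) X_smooth)).
have cY := cf _ sY.
pose Phi p := dot (H p) (nabla X Y p) + dot (N p) (Y p) + -1 * dot (g p) (H p).
have cPhi : continuous Phi.
  exact: (continuous_dot_combination cH cXY cN cY cg cH).
rewrite (L2inner_combination cH cXY cN cY cg cH) -/Phi.
(* On the torus this is [r (u + w') a], where [r] comes from the volume form and [(u + w') a] from
   the mixed term to be cancelled. In terms of [speed] and [dspeed] it is continuous everywhere and
   zero on the axis. *)
pose c r z := (speed X r + r * dspeed X r) * Y (polar r 0 z) 0 ix.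
have cst0 : continuous (fun _ : R * R => (0 : R)) by exact: cst_continuous.
have cc : continuous (fun x : R * R => c x.1 x.2).
  have cP0 : continuous (fun x : R * R => polar x.1 0 0).
    exact: (continuous_fcomp (continuous_pairf (continuous_pairf (@continuous_fstf R R) cst0) cst0)
      (@continuous_polar R)).
  have cPz : continuous (fun x : R * R => polar x.1 0 x.2).
    exact: (continuous_fcomp (continuous_pairf (continuous_pairf (@continuous_fstf R R) cst0) (@continuous_sndf R R))
      (@continuous_polar R)).
  have sXy := smooth_coord iy X_smooth.1.
  apply: continuous_mulf; last first.
    exact: (continuous_fcomp cPz (Ck_continuous (smooth_coord ix sY.1 0))).
  apply: continuous_addf.
    exact: (continuous_fcomp cP0 (Ck_continuous (sXy 0))).
  apply: (continuous_mulf (@continuous_fstf R R)).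
  exact: (continuous_fcomp cP0 (Ck_continuous (Ck_partial ix (sXy 1)))).
have k0 : cylint (fun r t z => c r z * dot (g (polar r t z)) (e_theta t)) = 0.
  apply: cylint_angular => // [z|]; last exact: (smooth_on_torus_pressure _).1.
  by rewrite /c (speedE X_def) ?lexx ?ler01// mulr0 mul0r addr0 mul0r.
have cPr : continuous3 (fun r t z => Phi (polar r t z) * r).
  by apply: continuous3M; [exact: continuous3_polar|exact: continuous3_r].
have ck : continuous3 (fun r t z => c r z * dot (g (polar r t z)) (e_theta t)).
  apply: continuous3M; last by apply: continuous3_dot_polar cg _; exact: continuous3_e_theta.
  apply: (continuous_fcomp (continuous_pairf (@continuous3_r R) _) cc).
  by move=> x; exact: cvg_snd.
have -> : torus_integral Phi = cylint (fun r t z => Phi (polar r t z) * r +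
    c r z * dot (g (polar r t z)) (e_theta t)).
  by rewrite (cylintD cPr ck) k0 addr0.
apply: cylint_ge0 (continuous3D cPr ck) _ => r t z r01.
rewrite /Phi mulN1r.
exact: (curvature_integrand_ge0 X_smooth X_def Y_tangent t z r01 (u_cond r r01)).
Qed.
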